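(* Let $\mathbf T=(T_1,\ldots,T_m)$ be a tuple of invertible real $d\times d$ matrices, let $\mu$ be an ergodic $\sigma$-invariant measure on $\Sigma$, and let $\Sigma'$, $\Lambda_1\ge\cdots\ge\Lambda_d$ and $\mathbf v(x)=\{v_i(x)\}_{i=1}^d$ ($x\in\Sigma'$) be the associated Oseledets data described in the context. Let $k\in\{1,\ldots,d-1\}$, $W\in G(d,k)$ and $s\in[0,k]$. For $x\in\Sigma'$ and $V\in G(d,k)$, let $(p_1(V,x),\ldots,p_k(V,x))$ denote the pivot position vector of $V$ with respect to the ordered basis $\mathbf v(x)$. Then for every $x\in\Sigma'$, $$\lim_{n\to\infty}\frac1n\log\varphi^s(T_{x|n}^*P_W)=\sum_{j=1}^{\lfloor s\rfloor}\Lambda_{p_j(W,x)}+(s-\lfloor s\rfloor)\Lambda_{p_{\lfloor s\rfloor+1}(W,x)},$$ and $$\lim_{n\to\infty}\frac1n\log\sup_{J\in\Sigma_*}\varphi^s(T_{x|n}^*P_{T_J^*W})=\sup_{J\in\Sigma_*}\left(\sum_{j=1}^{\lfloor s\rfloor}\Lambda_{p_j(T_J^*W,x)}+(s-\lfloor s\rfloor)\Lambda_{p_{\lfloor s\rfloor+1}(T_J^*W,x)}\right).$$ (When $s=k$, the terms with coefficient $s-\lfloor s\rfloor=0$ are read as $0$.)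
   Context: $d\ge2$. $\Sigma=\{1,\ldots,m\}^{\mathbb N}$ with left shift $\sigma$; $\Sigma_*$ is the set of finite words over $\{1,\ldots,m\}$ including the empty word. For $x\in\Sigma$, $x|n=x_1\cdots x_n$; $[I]$ is the cylinder of a word $I$; $T_I=T_{i_1}\cdots T_{i_n}$ for $I=i_1\cdots i_n$, $T_\emptyset=\mathrm{Id}$; $A^*$ is the transpose and $T_I^*=(T_I)^*$. $G(d,k)$ is the set of $k$-dimensional linear subspaces of $\mathbb R^d$; $P_W$ is the orthogonal projection onto $W$. Measures are Borel probability measures and $h_\mu(\sigma)$ is the measure-theoretic entropy. Singular value function: for a real $d\times d$ matrix $A$ with singular values $\alpha_1(A)\ge\cdots\ge\alpha_d(A)$ and $0\le s<d$, $\varphi^s(A)=\alpha_1(A)\cdots\alpha_j(A)\alpha_{j+1}(A)^{s-j}$, $j=\lfloor s\rfloor$ (convention $0^0=1$). Oseledets data: by Oseledets's multiplicative ergodic theorem and the Shannon–McMillan–Breiman theorem one can fix a measurable $\Sigma'\subset\Sigma$ with $\sigma(\Sigma')\subset\Sigma'$, $\mu(\Sigma')=1$, an integer $r\in\{1,\ldots,d\}$, reals $\lambda_1>\cdots>\lambda_r$, positive integers $d_1,\ldots,d_r$ with $\sum d_i=d$, and for each $x\in\Sigma'$ a splitting $\mathbb R^d=\bigoplus_{i=1}^rE_i(x)$, such that for every $x\in\Sigma'$: (1) $\dim E_i(x)=d_i$; (2) $T_{x_1}^*E_i(x)=E_i(\sigma x)$; (3) $\lim_n\frac1n\log\|T_{x|n}^*v\|=\lambda_i$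 for all $v\in E_i(x)\setminus\{0\}$; (4) $\lim_n\frac1n\log|\det T_{x|n}^*|=\sum_id_i\lambda_i$; (5) the maps $x\mapsto E_i(x)$ are measurable; (6) $\lim_n\frac1n\log\mu([x|n])=-h_\mu(\sigma)$. Moreover $\Lambda_1\ge\cdots\ge\Lambda_d$ is the list of the $\lambda_i$, each repeated $d_i$ times, and $\mathbf v(x)=\{v_1(x),\ldots,v_d(x)\}$ is a measurable ordered basis of $\mathbb R^d$ adapted to the splitting (the first $d_1$ vectors in $E_1(x)$, ..., the last $d_r$ in $E_r(x)$), and for all $x\in\Sigma'$, $\ell\in\{1,\ldots,d-1\}$ and $1\le i_1<\cdots<i_\ell\le d$: (7) $\lim_n\frac1n\log\|(T_{x|n}^* )^{\wedge\ell}(v_{i_1}(x)\wedge\cdots\wedge v_{i_\ell}(x))\|=\Lambda_{i_1}+\cdots+\Lambda_{i_\ell}$, where $A^{\wedge\ell}(u_1\wedge\cdots\wedge u_\ell)=Au_1\wedge\cdots\wedge Au_\ell$ and $(\mathbb R^d)^{\wedge\ell}$ has the inner product with $(u_1\wedge\cdots\wedge u_\ell\,|\,w_1\wedge\cdots\wedge w_\ell)=\det(\langle u_a,w_b\rangle)$. Pivot position vector: given $V\in G(d,k)$ and an ordered basis $\mathbf v=\{v_1,\ldots,v_d\}$ of $\mathbb R^d$, there is a unique $k\times d$ row-reduced echelon matrix $M=(M_{ij})$ of rank $k$ with $V=\mathrm{span}\{\sum_{j=1}^dM_{ij}v_j\colon i=1,\ldots,k\}$. If the leading nonzero entry of row $i$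 of $M$ is in column $p_i$ (so $p_1<\cdots<p_k$), then $(p_1,\ldots,p_k)$ is the pivot position vector of $V$ with respect to $\mathbf v$. *)

(* Defs.v *)
From HB Require Import structures.
From mathcomp Require Import all_boot all_order all_algebra.
From mathcomp Require Import all_classical all_reals all_analysis.
From mathcomp Require polyrcf.

Set Implicit Arguments.
Unset Strict Implicit.
Unset Printing Implicit Defensive.

Import Order.TTheory GRing.Theory Num.Theory.
Import numFieldNormedType.Exports.

Local Open Scope classical_set_scope.
Local Open Scope ring_scope.

(* The alphabet is 'I_m.+1, so that it is nonempty (which the existence of a
   probability measure forces anyway). Coordinates are numbered from 0: the
   first letter of x is x 0. *)
Definition letter_seq (m : nat) : Type :=
  prod_topology (fun _ : nat => discrete_topology 'I_m.+1).

HB.instance Definition _ (m : nat) := Topological.on (letter_seq m).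
HB.instance Definition _ (m : nat) :=
  isPointed.Build (letter_seq m) (fun=> ord0).

Definition Sigma (m : nat) : Type :=
  g_sigma_algebraType (@open (letter_seq m)).

HB.instance Definition _ (m : nat) := Measurable.on (Sigma m).

Section Symbolic.
Context {m : nat}.

Definition shift (x : Sigma m) : Sigma m := fun n => x n.+1.

Definition restr (x : Sigma m) (n : nat) : seq 'I_m.+1 := mkseq x n.

Definition cylinder (I : seq 'I_m.+1) : set (Sigma m) :=
  [set x | restr x (size I) = I].

End Symbolic.

Section Dynamics.
Context {R : realType} {m : nat}.
Implicit Type mu : probability (Sigma m) R.

Definition shift_invariant mu : Prop :=
  forall A : set (Sigma m), measurable A -> mu (shift @^-1` A) = mu A.

Definition shift_ergodic mu : Prop :=
  forall A : set (Sigma m), measurable A -> shift @^-1` A = A ->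
    mu A = 0%E \/ mu A = 1%E.

(* A finite measurable partition is given by its labelling map xi; the atoms of
   the join of the partitions shift^-i xi, i < N, are the fibres of
   itinerary xi N. *)
Definition itinerary (q : nat) (xi : Sigma m -> 'I_q) (N : nat) (x : Sigma m) :
  {ffun 'I_N -> 'I_q} := [ffun i : 'I_N => xi (iter i shift x)].

Definition join_entropy mu (q : nat) (xi : Sigma m -> 'I_q) (N : nat) : R :=
  \sum_(w : {ffun 'I_N -> 'I_q})
    let t := fine (mu (itinerary xi N @^-1` [set w])) in - (t * ln t).

Definition partition_entropy mu (q : nat) (xi : Sigma m -> 'I_q) : R :=
  limn (fun N : nat => N%:R^-1 * join_entropy mu xi N).

Definition entropy mu : \bar R :=
  ereal_sup [set h : \bar R | exists (q : nat) (xi : Sigma m -> 'I_q),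
    (forall a : 'I_q, measurable (xi @^-1` [set a])) /\
    h = (partition_entropy mu xi)%:E].

End Dynamics.

Section Linear.
Context {R : realType} {d : nat}.
Implicit Types (u v : 'cV[R]_d) (A : 'M[R]_d) (V W : {vspace 'cV[R]_d}).

Definition dot u v : R := \sum_i u i 0 * v i 0.

(* the norm of matrices in the library is the sup norm *)
Definition enorm u : R := Num.sqrt (dot u u).

(* the norm of u_1 /\ ... /\ u_l in the l-th exterior power *)
Definition wedge_norm (l : nat) (u : 'I_l -> 'cV[R]_d) : R :=
  Num.sqrt (\det (\matrix_(a < l, b < l) dot (u a) (u b))).

Definition mximg A W : {vspace 'cV[R]_d} := (linfun (mulmx A) @: W)%VS.

(* the kernel of the matrix whose rows are a basis of W *)
Definition orthc W : {vspace 'cV[R]_d} :=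
  lker (linfun (mulmx (\matrix_(i < \dim W, j < d) (vbasis W)`_i j 0))).

(* the matrix of the projection onto W along its orthogonal complement *)
Definition orthproj W : 'M[R]_d :=
  \matrix_(i < d, j < d) (daddv_pi W (orthc W) (delta_mx j 0)) i 0.

(* [:: alpha_1; ...; alpha_d], in nonincreasing order: the square roots of the
   eigenvalues of A^T A, counted with multiplicity; polyrcf.rootsR lists the
   real roots of a nonzero polynomial in increasing order. *)
Definition singular_values A : seq R :=
  let p := char_poly (A^T *m A) in
  rev [seq Num.sqrt a |
         a <- flatten [seq nseq (mup a p) a | a <- polyrcf.rootsR p]].

(* powR 0 0 = 1, and alpha_(j+1) has index j *)
Definition svf (s : R) A : R :=
  let j := Num.truncn s in
  let alpha := singular_values A in
  (\prod_(i < j) alpha`_i) * alpha`_j `^ (s - j%:R).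

Definition is_rref_with_pivots (k : nat) (M : 'M[R]_(k, d))
    (p : k.-tuple 'I_d) : Prop :=
  [/\ {homo tnth p : i i' / (i < i')%N},
      forall i, M i (tnth p i) = 1,
      forall i (j : 'I_d), (j < tnth p i)%N -> M i j = 0 &
      forall i i', i' != i -> M i' (tnth p i) = 0].

Definition is_pivot_vector (k : nat) (v : d.-tuple 'cV[R]_d) V
    (p : k.-tuple 'I_d) : Prop :=
  exists M : 'M[R]_(k, d),
    [/\ is_rref_with_pivots M p, \rank M = k &
        V = <<[seq (\sum_j M i j *: tnth v j)%R | i : 'I_k]>>%VS].

(* the unique pivot position vector when \dim V = k and v is a basis *)
Definition pivots (k : nat) (v : d.-tuple 'cV[R]_d) V : seq 'I_d :=
  if [pick p : k.-tuple 'I_d | `[< is_pivot_vector v V p >]] is Some p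
  then tval p else [::].

End Linear.

Lemma dotE (R : realType) (d : nat) (u v : 'cV[R]_d) :
  dot u v = (u^T *m v) 0 0.
Proof. by rewrite mxE; apply: eq_bigr => i _; rewrite mxE. Qed.

Lemma memv_orthc (R : realType) (d : nat) (W : {vspace 'cV[R]_d}) v :
  reflect (forall w, w \in W -> dot w v = 0) (v \in orthc W).
Proof.
rewrite memv_ker lfunE /=; apply: (iffP eqP) => [h w wW|h].
  rewrite (coord_vbasis wW) dotE linear_sum mulmx_suml summxE big1 // => i _.
  move/colP/(_ i): h; rewrite linearZ -scalemxAl !mxE => h.
  apply/eqP; rewrite mulf_eq0; apply/orP; right; apply/eqP; rewrite -[RHS]h.
  by apply: eq_bigr => j _; rewrite !mxE.
apply/colP => i; rewrite !mxE -[RHS](h (vbasis W)`_i).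
  by apply: eq_bigr => j _; rewrite mxE.
by apply/vbasis_mem/mem_nth; rewrite size_tuple.
Qed.

Lemma addv_orthc (R : realType) (d : nat) (W : {vspace 'cV[R]_d}) :
  (W :&: orthc W = 0)%VS /\ (W + orthc W = fullv)%VS.
Proof.
have cap0 : (W :&: orthc W = 0)%VS.
  apply/eqP; rewrite -subv0; apply/subvP => u.
  rewrite memv_cap memv0 => /andP[uW /memv_orthc/(_ u uW)/eqP].
  rewrite psumr_eq0 => [/allP u0|i _]; last by rewrite -expr2 sqr_ge0.
  apply/eqP/colP => i; rewrite mxE.
  by apply/eqP; have := u0 i (mem_index_enum i); rewrite mulf_eq0 orbb.
split=> //; apply/eqP; rewrite eqEdim subvf /= dimvf /dim /= muln1.
rewrite dimv_disjoint_sum //.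
have := limg_ker_dim (linfun (mulmx (\matrix_(i < \dim W, j < d)
  (vbasis W)`_i j 0) : 'cV_d -> 'cV_(\dim W))) fullv.
rewrite capfv -/(orthc W) dimvf /dim /= muln1 => {1}<-.
rewrite addnC leq_add2r (leq_trans (dimvS (subvf _))) //.
by rewrite dimvf /dim /= muln1.
Qed.

Lemma orthprojP (R : realType) (d : nat) (W : {vspace 'cV[R]_d}) u :
  (orthproj W *m u \in W) /\
  (forall w, w \in W -> dot w (u - orthproj W *m u) = 0).
Proof.
have [cap0 addT] := addv_orthc W.
have -> : orthproj W *m u = daddv_pi W (orthc W) u.
  have {2}-> : u = \sum_j u j 0 *: delta_mx j 0.
    by rewrite {1}[u]matrix_sum_delta; apply: eq_bigr => j _; rewrite big_ord1.
  rewrite linear_sum; apply/colP => i; rewrite mxE summxE.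
  by apply: eq_bigr => j _; rewrite linearZ !mxE mulrC.
split; first exact: memv_pi.
apply/memv_orthc; have uT : u \in (W + orthc W)%VS by rewrite addT memvf.
have <- := daddv_pi_add cap0 uT; rewrite addrAC.
have -> : daddv_pi W (orthc W)
   (daddv_pi W (orthc W) u + daddv_pi (orthc W) W u) = daddv_pi W (orthc W) u.
  by rewrite (daddv_pi_add cap0 uT).
by rewrite subrr add0r memv_pi.
Qed.

Section Oseledets.
Context {R : realType} {m d : nat}.
Variable T : 'I_m.+1 -> 'M[R]_d.

Definition mxword (I : seq 'I_m.+1) : 'M[R]_d := \big[mulmx/1%:M]_(i <- I) T i.

Definition mxword_tr (I : seq 'I_m.+1) : 'M[R]_d := (mxword I)^T.

(* the list 1, ..., 1, 2, ..., 2, ..., r, ..., r with dd i occurrences of i *)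
Definition blocks (r : nat) (dd : 'I_r -> nat) : seq 'I_r :=
  flatten [seq nseq (dd i) i | i <- enum 'I_r].

(* [:: Lambda_1; ...; Lambda_d] *)
Definition lyapunov_list (r : nat) (dd : 'I_r -> nat) (lam : 'I_r -> R) :
  seq R := [seq lam i | i <- blocks dd].

(* Measurability of x |-> E x i refers to the Borel structure of the
   Grassmannian, whose topology is the one induced by V |-> orthproj V. *)
Record oseledets_data (mu : probability (Sigma m) R) (S : set (Sigma m))
    (r : nat) (lam : 'I_r -> R) (dd : 'I_r -> nat)
    (E : Sigma m -> 'I_r -> {vspace 'cV[R]_d})
    (v : Sigma m -> d.-tuple 'cV[R]_d) : Prop := OseledetsData {
  os_measurable : measurable S;
  os_shift : shift @` S `<=` S;
  os_full : mu S = 1%E;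
  os_r : (1 <= r <= d)%N;
  os_lam : forall i j : 'I_r, (i < j)%N -> lam j < lam i;
  os_dd_gt0 : forall i, (0 < dd i)%N;
  os_dd_sum : (\sum_i dd i = d)%N;
  os_split : forall x, S x ->
    directv (\sum_i E x i)%VS /\ (\sum_i E x i)%VS = fullv;
  os_dim : forall x, S x -> forall i, \dim (E x i) = dd i;
  os_equivariant : forall x, S x ->
    forall i, mximg (T (x 0))^T (E x i) = E (shift x) i;
  os_exponent : forall x, S x -> forall i u, u \in E x i -> u != 0 ->
    n%:R^-1 * ln (enorm (mxword_tr (restr x n) *m u))
      @[n --> \oo] --> lam i;
  os_det : forall x, S x ->
    n%:R^-1 * ln `|\det (mxword_tr (restr x n))|
      @[n --> \oo] --> \sum_i (dd i)%:R * lam i;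
  os_E_measurable : forall i a b,
    measurable_fun S (fun x => orthproj (E x i) a b : R);
  os_entropy : forall x, S x ->
    ((n%:R^-1)%:E * lne (mu (cylinder (restr x n))))%E
      @[n --> \oo] --> (- entropy mu)%E;
  os_v_measurable : forall j a,
    measurable_fun S (fun x => tnth (v x) j a 0 : R);
  os_v_basis : forall x, S x -> basis_of fullv (v x);
  os_v_adapted : forall x, S x ->
    all2 (fun u i => u \in E x i) (v x) (blocks dd);
  os_wedge : forall x, S x -> forall (l : nat) (i : 'I_l -> 'I_d),
    (1 <= l <= d.-1)%N -> {homo i : a b / (a < b)%N} ->
    n%:R^-1 * ln (wedge_norm
        (fun a => mxword_tr (restr x n) *m tnth (v x) (i a)))
      @[n --> \oo] --> \sum_a (lyapunov_list dd lam)`_(i a)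
}.

End Oseledets.

(* If Lp = [:: Lambda_(p_1); ...; Lambda_(p_k)], this is
   Lp_1 + ... + Lp_j + (s - j) Lp_(j+1) with j = floor s; when s = k, the last
   term is 0. *)
Definition pivot_exponent (R : realType) (d : nat) (s : R) (Lambda : seq R)
    (p : seq 'I_d) : R :=
  let j := Num.truncn s in
  let Lp := [seq Lambda`_i | i : 'I_d <- p] in
  \sum_(i < j) Lp`_i + (s - j%:R) * Lp`_j.

(* Main.v *)
Require Import Defs.
From HB Require Import structures.
From mathcomp Require Import all_boot all_order all_algebra.
From mathcomp Require Import all_classical all_reals all_analysis.
From mathcomp Require polyrcf.
From mathcomp Require Import perm complex.
From mathcomp Require Import ring lra.

Set Implicit Arguments.
Unset Strict Implicit.
Unset Printing Implicit Defensive.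

Import Order.TTheory GRing.Theory Num.Theory.
Import numFieldNormedType.Exports.

Local Open Scope classical_set_scope.
Local Open Scope ring_scope.

(** Write [A n] for the transposed product over the first [n] letters of [x], let
    [v_1, ..., v_d] be the adapted basis (all indices start from 1 here), and let
    [V] be a [k]-dimensional subspace with pivots [p_1 < ... < p_k] and echelon rows
    [u_a = v_(p_a) + (later v_j)].  Everything follows from the claim that each
    singular value [alpha_i] of [A n P_V], [i <= k], has exponential rate
    [Lambda_(p_i)]: [phi^s] is a product of powers of these singular values.

    For the upper bound, constrain [w] by [i - 1] linear equations so that
    [P_V w] lies in the span of [u_i, ..., u_k], hence in the span of the [v_j]
    with [j >= p_i].  There [|A n P_V w|] is at most a constant times
    [|w|] times the sum of the [|A n v_j|], whose rates are at most
    [Lambda_(p_i)]; the Courant-Fischer principle gives [alpha_i] the same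
    bound ([singular_value_pivot_le]).  The constant depends on the basis only,
    not on [V].

    For the lower bound, take [w] in the span of [u_1, ..., u_i].  Its
    coordinate on [v_(p_a)] is its [a]-th coordinate on the [u]'s, and Cramer's
    rule with a crude Hadamard inequality bounds a coordinate of [w] on [v_j] by
    a constant times [|A n w|] times the product of the [|A n v_l|], [l <> j],
    divided by [|det (A n)|].  The rate of [|det (A n)|] is the sum of all
    [Lambda_l] (Lyapunov regularity), so that this factor has rate at most
    [- Lambda_j]; hence [|w|] is at most [|A n w|] times a factor of rate at most
    [- Lambda_(p_i)], and Courant-Fischer applies again
    ([singular_value_pivot_ge]).

    The upper bound being uniform in [V], and the possible pivot vectors being
    finitely many, it passes to the supremum over words; the lower bound is used
    for a single word whose exponent is almost optimal ([sup_svf_growth]).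

    The Courant-Fischer principle is derived from the spectral theorem for real
    symmetric matrices, and pivot vectors exist by Gaussian elimination in the
    form of a greedy choice of independent columns ([echelon_form]). *)

(** * The spectral theorem for real symmetric matrices *)

(** There is a complex eigenvalue [z], with row eigenvector [u].  The number
    [u A u^*] is its own conjugate and equals [z |u|^2], so [z] is real, and a
    real root of the characteristic polynomial is an eigenvalue over [R]. *)
Lemma symmetric_eigenvalue (R : rcfType) (n : nat) (A : 'M[R]_n) :
  (0 < n)%N -> A^T = A -> exists a, eigenvalue A a.
Proof.
move=> n_gt0 symA; pose f := real_complex R; pose Af := map_mx f A.
have conjAf : map_mx Num.conj Af = Af.
  apply/matrixP => i j; rewrite !mxE; apply/eqP.
  by rewrite eq_complex /= oppr0 !eqxx.
have [z z_eig] := eigenvalue_closed Af n_gt0.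
have z_real : z \is Num.real.
  case/eigenvalueP: z_eig => u uA u_neq0; pose w := (map_mx Num.conj u)^T.
  have uwE : (u *m w) 0 0 = \sum_i u 0 i * Num.conj (u 0 i).
    by rewrite mxE; apply: eq_bigr => i _; rewrite !mxE.
  have N_gt0 : 0 < (u *m w) 0 0.
    rewrite uwE lt_def sumr_ge0 ?andbT => [|i _]; last exact: mul_conjC_ge0.
    rewrite psumr_eq0 => [|i _]; last exact: mul_conjC_ge0.
    apply: contra u_neq0 => /allP u0; apply/eqP/rowP => i; rewrite [RHS]mxE.
    by apply/eqP; rewrite -mul_conjC_eq0; apply: u0 (mem_index_enum i).
  have zN : (u *m Af *m w) 0 0 = z * (u *m w) 0 0.
    by rewrite uA -scalemxAl mxE.
  have : z * (u *m w) 0 0 \is Num.real.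
    apply/CrealP; rewrite -zN.
    transitivity (map_mx Num.conj (u *m Af *m w) 0 0); first by rewrite [RHS]mxE.
    rewrite !map_mxM conjAf /w map_trmx -map_mx_comp (map_mx_id (@conjCK _)).
    transitivity ((w^T *m Af *m u^T)^T 0 0); first by rewrite [RHS]mxE /w trmxK.
    by rewrite !trmx_mul !trmxK /Af /w !map_trmx symA mulmxA.
  by rewrite (realrM _ (lt0r_neq0 N_gt0) (gtr0_real N_gt0)).
move: z_eig; have /complex_realP[a ->] := z_real.
rewrite eigenvalue_root_char -map_char_poly fmorph_root.
by rewrite -eigenvalue_root_char; exists a.
Qed.

Lemma rv_dot_eq0 (R : realDomainType) (n : nat) (u : 'rV[R]_n) :
  (u *m u^T == 0) = (u == 0).
Proof.
apply/eqP/eqP => [uu|->]; last by rewrite mul0mx.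
have /eqP : (u *m u^T) 0 0 = 0 by rewrite uu mxE.
rewrite mxE psumr_eq0 => [/allP u0|i _]; last by rewrite mxE -expr2 sqr_ge0.
apply/rowP => i; rewrite [RHS]mxE; apply/eqP.
by have := u0 i (mem_index_enum i); rewrite mxE mulf_eq0 orbb.
Qed.

(** The orthogonal reflection in the hyperplane that bisects [e] and [u] swaps
    these two vectors of equal length.  It serves to move a unit eigenvector to
    the first basis vector without an orthonormal completion. *)
Lemma householder_reflection (R : realFieldType) (n : nat) (e u : 'rV[R]_n) :
  e *m e^T = u *m u^T ->
  exists2 H : 'M[R]_n, H^T = H /\ H *m H = 1%:M & e *m H = u.
Proof.
move=> eu; pose w := u - e.
have [w0|w_neq0] := eqVneq w 0.
  exists 1%:M; first by rewrite trmx1 mulmx1.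
  by rewrite mulmx1; apply/esym/eqP; rewrite -subr_eq0; apply/eqP.
(* with w = u - e, the reflection is x |-> x - 2 (x w^T / |w|^2) w *)
pose N := (w *m w^T) 0 0.
have wwN : w *m w^T = N%:M by apply/matrixP => i j; rewrite !ord1 [RHS]mxE eqxx.
have N_neq0 : N != 0.
  by apply: contra w_neq0 => /eqP N0; rewrite -rv_dot_eq0 wwN N0 raddf0.
have ew : e *m w^T = (- (N / 2))%:M.
  have ue : u *m e^T = e *m u^T.
    apply/matrixP => i j; rewrite !ord1 !mxE; apply: eq_bigr => l _.
    by rewrite !mxE mulrC.
  have : w *m w^T = - (e *m w^T) - (e *m w^T).
    rewrite /w [(u - e)^T]linearB /= !(mulmxBl, mulmxBr) ue eu.
    by rewrite !opprB.
  rewrite wwN [e *m w^T]mx11_scalar; move: ((e *m w^T) 0 0) => y /matrixP/(_ 0 0).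
  by rewrite !mxE eqxx !mulr1n => ->; congr _%:M; field.
have {eu} ueE : u = e + w by rewrite /w addrC subrK.
clearbody N w.
exists (1%:M - (2 / N) *: (w^T *m w)); first split.
- by rewrite linearB linearZ /= trmx1 trmx_mul trmxK.
- rewrite mulmxBl mul1mx mulmxBr mulmx1 -scalemxAl -scalemxAr mulmxA.
  rewrite -[w^T *m w *m w^T]mulmxA wwN mul_mx_scalar -scalemxAl !scalerA.
  set ww := w^T *m w; apply/matrixP => i j; rewrite !mxE.
  by field.
- rewrite mulmxBr mulmx1 -scalemxAr mulmxA ew mul_scalar_mx scalerA.
  have -> : 2 / N * - (N / 2) = -1 by field.
  by rewrite scaleN1r opprK.
Qed.

(** Conjugating by a reflection that sends the first basis vector to a unit
    eigenvector makes the first row, hence by symmetry the first column, vanish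
    off the diagonal; the remaining block is symmetric of smaller size. *)
Lemma spectral_theorem (R : rcfType) (n : nat) (A : 'M[R]_n) : A^T = A ->
  exists (Q : 'M[R]_n) (D : 'rV[R]_n),
    Q^T *m Q = 1%:M /\ A = Q *m diag_mx D *m Q^T.
Proof.
elim: n A => [|n IHn] A symA.
  exists 1%:M, 0; split; first by rewrite trmx1 mulmx1.
  by apply/matrixP => -[].
have [a /eigenvalueP[u uA u_neq0]] := symmetric_eigenvalue (ltn0Sn n) symA.
pose e : 'rV[R]_(1 + n) := delta_mx 0 0.
pose N := (u *m u^T) 0 0.
have uuN : u *m u^T = N%:M by apply/matrixP => i j; rewrite !ord1 [RHS]mxE eqxx.
have N_gt0 : 0 < N.
  rewrite lt_def; apply/andP; split.
    by apply: contra u_neq0 => /eqP N0; rewrite -rv_dot_eq0 uuN N0 raddf0.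
  by rewrite /N mxE sumr_ge0 // => i _; rewrite mxE -expr2 sqr_ge0.
pose u1 := (Num.sqrt N)^-1 *: u.
have sqrN : Num.sqrt N != 0 by rewrite gt_eqF ?sqrtr_gt0.
have u1A : u1 *m A = a *: u1 by rewrite -scalemxAl uA /u1 !scalerA mulrC.
have eu1 : e *m e^T = u1 *m u1^T.
  rewrite /u1 linearZ /= -scalemxAl -scalemxAr uuN !scale_scalar_mx.
  rewrite trmx_delta mul_delta_mx -{3}[N]sqr_sqrtr ?ltW // expr2.
  rewrite mulKf // mulVf //.
  by apply/matrixP => i j; rewrite !ord1 !mxE !eqxx.
have [H [symH HH] eH] := householder_reflection eu1.
pose B : 'M[R]_(1 + n) := H *m A *m H.
have symB : B^T = B by rewrite /B !trmx_mul symH symA mulmxA.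
have eB : e *m B = a *: e.
  by rewrite /B !mulmxA eH u1A -scalemxAl -eH -mulmxA HH mulmx1.
have B0j j : B 0 j = a *+ (j == 0).
  move/rowP/(_ j): eB; rewrite -rowE !mxE eqxx /= => ->.
  by case: (j == 0); rewrite ?mulr1 ?mulr0.
have AE : A = H *m B *m H.
  by rewrite /B !mulmxA HH mul1mx -mulmxA HH mulmx1.
clearbody B.
pose B' := drsubmx B.
have symB' : B'^T = B' by rewrite /B' trmx_drsub symB.
have [Q' [D' [QQ' B'E]]] := IHn B' symB'.
have BE : B = block_mx a%:M 0 0 B'.
  rewrite -[LHS]submxK; congr block_mx.
  - by apply/matrixP => i j; rewrite !ord1 !mxE lshift0 B0j.
  - apply/matrixP => i j; rewrite !ord1 !mxE lshift0 B0j.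
    by rewrite -val_eqE.
  - apply/matrixP => i j; rewrite !ord1 !mxE lshift0 -symB mxE B0j.
    by rewrite -val_eqE.
pose P : 'M[R]_(1 + n) := block_mx 1%:M 0 0 Q'.
have PtE : P^T = block_mx 1%:M 0 0 Q'^T by rewrite tr_block_mx !trmx0 trmx1.
have PP : P^T *m P = 1%:M.
  rewrite PtE mulmx_block !mulmx0 !mul0mx !mulmx1 QQ'.
  by rewrite !addr0 add0r -scalar_mx_block.
have BP : B = P *m diag_mx (row_mx a%:M D') *m P^T.
  rewrite PtE diag_mx_row BE B'E !mulmx_block.
  rewrite !(mulmx0, mul0mx, mulmx1, mul1mx, addr0, add0r); congr block_mx.
  by apply/matrixP => i j; rewrite !ord1 !mxE eqxx.
exists (H *m P : 'M[R]_n.+1); exists (row_mx a%:M D' : 'rV[R]_n.+1); split.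
  by rewrite trmx_mul symH mulmxA -[_ *m H *m H]mulmxA HH mulmx1.
by rewrite trmx_mul symH AE BP !mulmxA.
Qed.

(** * Singular values and the Courant-Fischer principle *)

Lemma char_poly_diagonalized (R : fieldType) (n : nat) (Q : 'M[R]_n)
    (D : 'rV[R]_n) : Q^T *m Q = 1%:M ->
  char_poly (Q *m diag_mx D *m Q^T) =
    \prod_(a <- [seq D 0 i | i : 'I_n]) ('X - a%:P).
Proof.
move=> QtQ; have QQt : Q *m Q^T = 1%:M by exact: mulmx1C.
rewrite big_map big_enum /=; transitivity (char_poly (diag_mx D)); last first.
  rewrite char_poly_trig ?diag_mx_is_trig //.
  by apply: eq_bigr => i _; rewrite mxE eqxx.
rewrite /char_poly /char_poly_mx.
have -> : 'X%:M - map_mx polyC (Q *m diag_mx D *m Q^T) =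
    map_mx polyC Q *m ('X%:M - map_mx polyC (diag_mx D)) *m map_mx polyC Q^T.
  rewrite mulmxBr mulmxBl -!map_mxM; congr (_ - _).
  by rewrite scalar_mxC -mulmxA -map_mxM QQt map_mx1 mulmx1.
rewrite !det_mulmx mulrAC -det_mulmx -map_mxM QQt map_mx1 det1 mul1r //.
Qed.

Lemma pairwise_flatten_nseq (T : eqType) (r r' : rel T) (f : T -> nat)
    (s : seq T) :
    (forall x y, r x y -> r' x y) -> reflexive r' -> pairwise r s ->
  pairwise r' (flatten [seq nseq (f x) x | x <- s]).
Proof.
move=> rr' r'xx; elim: s => //= x s IHs /andP[/allP xs /IHs{}IHs].
rewrite pairwise_cat IHs andbT; apply/andP; split.
  apply/allrelP => y z /nseqP[-> _] /flatten_mapP[t ts /nseqP[-> _]].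
  exact/rr'/xs.
elim: (f x) => //= n ->; rewrite andbT.
by apply/allP => y /nseqP[-> _].
Qed.

(** The list of roots repeated according to multiplicity is the increasing
    rearrangement of [s]; this identifies the singular values with the square
    roots of the diagonal entries that the spectral theorem produces. *)
Lemma sorted_root_list (R : rcfType) (s : seq R) :
  let p := \prod_(a <- s) ('X - a%:P) in
  let t := flatten [seq nseq (mup a p) a | a <- polyrcf.rootsR p] in
  sorted <=%R t /\ perm_eq t s.
Proof.
move=> p t; have p_neq0 : p != 0 by rewrite monic_neq0 ?monic_prod_XsubC.
split.
  rewrite sorted_pairwise; last exact: le_trans.
  apply: (pairwise_flatten_nseq (r := <%R)) => [x y /ltW//||].
    exact: lexx.
  by rewrite -sorted_pairwise; [exact: polyrcf.sorted_roots | exact: lt_trans].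
apply: perm_trans (perm_count_undup s).
rewrite /t (eq_map (g := fun a => nseq (count_mem a s) a)) => [|a]; last first.
  by rewrite mu_prod_XsubC.
apply/perm_flatten/perm_map/uniq_perm; rewrite ?undup_uniq //.
  exact: polyrcf.uniq_roots.
move=> a; rewrite mem_undup -[RHS]root_prod_XsubC -/p.
by have := polyrcf.roots_on_rootsR p_neq0 a; rewrite in_itv /= => ->.
Qed.

(** The columns of [Q] are right singular vectors, numbered in the order of the
    list of singular values: permute the columns given by the spectral theorem
    for [X^T X]. *)
Lemma singular_basis (R : realType) (d : nat) (X : 'M[R]_d) :
  let alpha := singular_values X in
  [/\ sorted >=%R alpha, {in alpha, forall a, 0 <= a} &
   exists Q : 'M[R]_d, Q^T *m Q = 1%:M /\
    (X *m Q)^T *m (X *m Q) = diag_mx (\row_i (alpha`_i ^+ 2))].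
Proof.
move=> alpha; have symXX : (X^T *m X)^T = X^T *m X by rewrite trmx_mul trmxK.
have [Q [D [QtQ XXE]]] := spectral_theorem symXX.
have := sorted_root_list [seq D 0 i | i : 'I_d].
rewrite -(char_poly_diagonalized _ QtQ) -XXE /= => -[].
set t := flatten _ => t_sorted t_perm.
have alphaE : alpha = rev [seq Num.sqrt a | a <- t] by [].
split.
- rewrite alphaE rev_sorted; apply: homo_sorted t_sorted => x y.
  exact: ler_wsqrtr.
- by move=> a; rewrite alphaE mem_rev => /mapP[b _ ->]; exact: sqrtr_ge0.
have alpha_perm : perm_eq alpha [tuple Num.sqrt (D 0 i) | i < d].
  rewrite alphaE perm_rev /= (perm_trans (perm_map _ t_perm)) // -map_comp.
  by rewrite /= /image_mem.
have [p pE] := tuple_permP alpha_perm.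
have alphai (i : 'I_d) : alpha`_i = Num.sqrt (D 0 (p i)).
  by rewrite pE /= (nth_map i) ?size_enum_ord // nth_ord_enum !tnth_mktuple.
have QXXQ : (X *m Q)^T *m (X *m Q) = diag_mx D.
  rewrite trmx_mul mulmxA -[_ *m X^T *m X]mulmxA XXE !mulmxA QtQ mul1mx.
  by rewrite -mulmxA QtQ mulmx1.
have D_ge0 i : 0 <= D 0 i.
  move/matrixP: QXXQ => /(_ i i); rewrite [RHS]mxE eqxx mulr1n => <-.
  by rewrite mxE sumr_ge0 // => l _; rewrite mxE -expr2 sqr_ge0.
have QpE : X *m col_perm p Q = col_perm p (X *m Q).
  apply/matrixP => i j; rewrite mxE [RHS]mxE mxE.
  by apply: eq_bigr => l _; rewrite [in LHS]mxE.
have gram_perm (Y : 'M[R]_d) : (col_perm p Y)^T *m col_perm p Y =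
    \matrix_(i, j) (Y^T *m Y) (p i) (p j).
  apply/matrixP => i j; rewrite [RHS]mxE !mxE.
  by apply: eq_bigr => l _; rewrite !mxE.
exists (col_perm p Q); rewrite QpE !gram_perm QtQ QXXQ; split.
  by apply/matrixP => i j; rewrite !mxE (inj_eq perm_inj).
apply/matrixP => i j; rewrite !mxE (inj_eq perm_inj).
by rewrite alphai sqr_sqrtr.
Qed.
Section EuclideanNorm.
Context {R : realType} {d : nat}.
Implicit Types (u w : 'cV[R]_d) (Q : 'M[R]_d).

Lemma dot_ge0 u : 0 <= dot u u.
Proof. by apply: sumr_ge0 => i _; rewrite -expr2 sqr_ge0. Qed.

Lemma dot_eq0 u : (dot u u == 0) = (u == 0).
Proof.
rewrite psumr_eq0 => [|i _]; last by rewrite -expr2 sqr_ge0.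
apply/allP/eqP => [u0|-> i _]; last by rewrite mxE mul0r eqxx.
apply/colP => i; rewrite mxE; apply/eqP.
by have := u0 i (mem_index_enum i); rewrite mulf_eq0 orbb.
Qed.

Lemma enorm_ge0 u : 0 <= enorm u.
Proof. exact: sqrtr_ge0. Qed.

Lemma sqr_enorm u : enorm u ^+ 2 = dot u u.
Proof. by rewrite sqr_sqrtr ?dot_ge0. Qed.

Lemma enorm_gt0 u : (0 < enorm u) = (u != 0).
Proof. by rewrite sqrtr_gt0 lt_def dot_ge0 andbT dot_eq0. Qed.

Lemma dot_orthogonal Q u : Q^T *m Q = 1%:M -> dot (Q *m u) (Q *m u) = dot u u.
Proof.
by move=> QQ; rewrite !dotE trmx_mul mulmxA -[_ *m Q^T *m Q]mulmxA QQ mulmx1.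
Qed.

End EuclideanNorm.

(** Fewer equations than unknowns, in the form used for both halves of the
    Courant-Fischer principle: [i] equations in the [i + 1] unknowns
    [e_0, ..., e_i]. *)
Lemma nonzero_solution (F : fieldType) (n : nat) (K : nat -> 'rV[F]_n)
    (i : 'I_n) :
  exists2 e : 'cV[F]_n, e != 0 &
    (forall b : 'I_n, (i < b)%N -> e b 0 = 0) /\
    (forall a, (a < i)%N -> K a *m e = 0).
Proof.
(* a square system: the equations, a zero row, and e_b = 0 for b > i; the zero
   row makes it singular *)
pose M : 'M[F]_n := \matrix_(a, b)
  if (a < i)%N then K a 0 b else ((a != i) && (a == b))%:R.
have rowMlt (a : 'I_n) : (a < i)%N -> row a M = K a.
  by move=> ai; apply/rowP => b; rewrite !mxE ai.
have detM : \det M^T == 0.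
  rewrite det_tr (expand_det_row _ i) big1 // => b _.
  by rewrite mxE ltnn eqxx mul0r.
have [v v_neq0 vM] := det0P detM.
have Mv : M *m v^T = 0 by rewrite -[LHS]trmxK trmx_mul trmxK vM trmx0.
exists v^T; first by rewrite trmx_eq0.
split=> [b ib|a ai].
  have /colP/(_ b) := Mv; rewrite !mxE (bigD1 b) //= big1 => [|c cb].
    by rewrite !mxE ltnNge (ltnW ib) /= -val_eqE gtn_eqF //= eqxx mul1r addr0.
  by rewrite !mxE ltnNge (ltnW ib) /= [b == c]eq_sym (negPf cb) andbF mul0r.
have an := ltn_trans ai (ltn_ord i).
by rewrite -(rowMlt (Ordinal an)) // -row_mul Mv; apply/rowP => j; rewrite !mxE.
Qed.

Section CourantFischer.
Context {R : realType} {d : nat}.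
Variable X : 'M[R]_d.
Let alpha := singular_values X.

Lemma singular_value_ge0 i : 0 <= alpha`_i.
Proof.
have [_ a_ge0 _] := singular_basis X.
by have [/(mem_nth 0)/a_ge0//|/(nth_default 0) ->] := ltnP i (size alpha).
Qed.

Lemma singular_value_nonincr i j : (i <= j)%N -> alpha`_j <= alpha`_i.
Proof.
move=> ij; have [a_sorted _ _] := singular_basis X.
have [ja|/(nth_default 0) ->] := ltnP j (size alpha); last first.
  exact: singular_value_ge0.
have := sorted_leq_nth (rev_trans le_trans) lexx 0 a_sorted.
by apply; rewrite ?inE // (leq_ltn_trans ij).
Qed.

Lemma singular_coordinates : exists Q : 'M[R]_d, [/\ Q^T *m Q = 1%:M,
  forall e, dot (Q *m e) (Q *m e) = dot e e &
  forall e, dot (X *m (Q *m e)) (X *m (Q *m e)) =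
    \sum_(a < d) alpha`_a ^+ 2 * e a 0 ^+ 2].
Proof.
have [_ _ [Q [QQ XQ]]] := singular_basis X.
exists Q; split=> // e; first exact: dot_orthogonal.
rewrite mulmxA dotE trmx_mul mulmxA -[_ *m _ *m (X *m Q)]mulmxA XQ mxE.
apply: eq_bigr => a _; rewrite mul_mx_diag !mxE.
by rewrite mulrC mulrCA mulrA -expr2 mulrC -/alpha mulrC.
Qed.

(** The span of the first [i + 1] singular vectors contains a nonzero [w]
    satisfying the [i] equations [N a w = 0], and there
    [|X w| >= alpha_i |w|]. *)
Lemma singular_value_le (i : 'I_d) (N : nat -> 'rV[R]_d) (C : R) : 0 <= C ->
    (forall w, (forall a, (a < i)%N -> N a *m w = 0) ->
       enorm (X *m w) <= C * enorm w) ->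
  alpha`_i <= C.
Proof.
move=> C_ge0 XC; have [Q [_ Qe XQe]] := singular_coordinates.
have [e e_neq0 [e0 Ne]] := nonzero_solution (fun a => N a *m Q) i.
have E_gt0 : 0 < dot e e by rewrite lt_def dot_eq0 e_neq0 dot_ge0.
have := XC (Q *m e).
rewrite -(ler_sqr (enorm_ge0 _)) ?nnegrE ?mulr_ge0 ?enorm_ge0 //.
rewrite exprMn !sqr_enorm Qe XQe => h.
rewrite -ler_sqr ?nnegrE ?singular_value_ge0 // -(ler_pM2r E_gt0).
apply: le_trans (h _) => [|a ai]; last by rewrite mulmxA Ne.
rewrite mulr_sumr ler_sum // => a _; rewrite -expr2.
have [ai|ia] := leqP a i; last by rewrite e0 // expr0n !mulr0.
rewrite ler_wpM2r ?sqr_ge0 // ler_sqr ?nnegrE ?singular_value_ge0 //.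
exact: singular_value_nonincr.
Qed.

(** The span of the first [i + 1] columns of [Y] contains a nonzero vector
    orthogonal to the first [i] singular vectors, and there
    [|X w| <= alpha_i |w|]. *)
Lemma singular_value_ge (k : nat) (Y : 'M[R]_(d, k)) (i : 'I_k) (C : R) : 0 <= C ->
    (forall e : 'cV[R]_k, e != 0 -> (forall b : 'I_k, (i < b)%N -> e b 0 = 0) ->
       Y *m e != 0 /\ enorm (Y *m e) <= C * enorm (X *m (Y *m e))) ->
  1 <= C * alpha`_i.
Proof.
move=> C_ge0 XC; have [Q [QQ Qe XQe]] := singular_coordinates.
pose K a : 'rV[R]_k := if insub a is Some a' then row a' (Q^T *m Y) else 0.
have [e e_neq0 [e0 Ke]] := nonzero_solution K i.
have [Ye_neq0] := XC e e_neq0 e0.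
pose f := Q^T *m (Y *m e).
have YeE : Y *m e = Q *m f by rewrite /f mulmxA (mulmx1C QQ) mul1mx.
have f0 (a : 'I_d) : (a < i)%N -> f a 0 = 0.
  move=> ai; have := Ke a ai; rewrite /K valK -row_mul -mulmxA -/f => /rowP/(_ 0).
  by rewrite mxE => ->; rewrite mxE.
have E_gt0 : 0 < dot f f by rewrite -Qe -YeE lt_def dot_eq0 Ye_neq0 dot_ge0.
rewrite -(ler_sqr (enorm_ge0 _)) ?nnegrE ?mulr_ge0 ?enorm_ge0 //.
rewrite exprMn !sqr_enorm YeE Qe XQe => h.
rewrite -(ler_sqr ler01) ?nnegrE ?mulr_ge0 ?singular_value_ge0 // expr1n exprMn.
rewrite -(ler_pM2r E_gt0) mul1r (le_trans h) // -[leRHS]mulrA ler_wpM2l ?sqr_ge0 //.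
rewrite mulr_sumr ler_sum // => a _; rewrite -expr2.
have [ia|ai] := leqP i a; last by rewrite f0 // expr0n !mulr0.
rewrite ler_wpM2r ?sqr_ge0 // ler_sqr ?nnegrE ?singular_value_ge0 //.
exact: singular_value_nonincr.
Qed.

End CourantFischer.

(** * Pivot vectors *)

Section GreedyBasis.
Context {K : fieldType} {vT : vectType K}.
Variable c : nat -> vT.

Definition pivot_indices n := [seq j <- iota 0 n | c j \notin <<mkseq c j>>%VS].

Lemma pivot_indicesS n : pivot_indices n.+1 =
  pivot_indices n ++ (if c n \in <<mkseq c n>>%VS then [::] else [:: n]).
Proof.
rewrite /pivot_indices -addn1 iotaD filter_cat /= add0n.
by case: ifP => //; case: (_ \in _).
Qed.

Lemma span_pivot_indices n :
  <<map c (pivot_indices n)>>%VS = <<mkseq c n>>%VS.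
Proof.
elim: n => // n IHn.
rewrite pivot_indicesS mkseqS map_cat span_cat IHn -cats1 span_cat.
case: ifP => //= cn; rewrite span_nil addv0 span_seq1.
by apply/esym/addv_idPl; rewrite -memvE.
Qed.

Lemma free_pivot_indices n : free (map c (pivot_indices n)).
Proof.
elim: n => [|n IHn]; first by rewrite nil_free.
rewrite pivot_indicesS map_cat; case: ifP => /= cn; first by rewrite cats0.
rewrite (perm_free (Y := c n :: map c (pivot_indices n))); last first.
  by rewrite cats1 perm_rcons.
by rewrite free_cons span_pivot_indices cn.
Qed.

Lemma sorted_pivot_indices n : sorted ltn (pivot_indices n).
Proof. exact: (sorted_filter ltn_trans) (iota_ltn_sorted 0 n). Qed.

End GreedyBasis.

Section Columns.
Context {K : fieldType} {d : nat}.

Definition mxcols (n : nat) (t : n.-tuple 'cV[K]_d) : 'M[K]_(d, n) :=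
  \matrix_(i, j) tnth t j i 0.

Lemma mulmx_cols (n : nat) (A : 'M[K]_(d, n)) (e : 'cV[K]_n) :
  A *m e = \sum_j e j 0 *: col j A.
Proof.
apply/colP => i; rewrite mxE summxE; apply: eq_bigr => j _.
by rewrite !mxE mulrC.
Qed.

Lemma col_mxcols (n : nat) (t : n.-tuple 'cV[K]_d) j : col j (mxcols t) = tnth t j.
Proof. by apply/colP => i; rewrite !mxE. Qed.

Lemma mem_span_col (n : nat) (A : 'M[K]_(d, n)) (w : 'cV[K]_d) :
  reflect (exists e, w = A *m e) (w \in <<[seq col j A | j : 'I_n]>>%VS).
Proof.
apply: (iffP idP) => [wA|[e ->]]; last first.
  rewrite mulmx_cols; apply: memv_suml => j _; apply/memvZ/memv_span.
  by apply/mapP; exists j; rewrite ?mem_enum.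
pose t := [tuple col j A | j < n].
exists (\col_j coord t j w); rewrite {1}(@coord_span _ _ _ t w) //.
rewrite mulmx_cols; apply: eq_bigr => j _.
by rewrite -tnth_nth tnth_mktuple mxE.
Qed.

Lemma free_mxcols (n : nat) (t : n.-tuple 'cV[K]_d) (e : 'cV[K]_n) :
  free t -> mxcols t *m e = 0 -> e = 0.
Proof.
move=> /freeP t_free te; apply/colP => j; rewrite [RHS]mxE.
apply: (t_free (fun j => e j 0)); rewrite -[RHS]te mulmx_cols.
by apply: eq_bigr => l _; rewrite col_mxcols (tnth_nth 0).
Qed.

Lemma mxcols_unit (v : d.-tuple 'cV[K]_d) : basis_of fullv v -> mxcols v \in unitmx.
Proof.
move=> /basis_free v_free; rewrite -unitmx_tr unitmxE unitfE.
apply/det0P => -[u u_neq0 uv]; case/negP: u_neq0.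
rewrite -trmx_eq0; apply/eqP/(free_mxcols v_free).
by rewrite -[LHS]trmxK trmx_mul trmxK uv trmx0.
Qed.

End Columns.

(** The pivots are the columns of [N] that are independent of the earlier ones,
    and [G] inverts the square submatrix that they form, so that [G N] has unit
    vectors in the pivot columns.  A column [j] before the [i]-th pivot is a
    combination of pivot columns up to [j], none of which is the [i]-th, so its
    [i]-th entry in [G N] is zero. *)
Lemma echelon_form (K : fieldType) (d k : nat) (N : 'M[K]_(k, d)) :
  row_free N -> exists (p : k.-tuple 'I_d) (G : 'M[K]_k),
   [/\ G \in unitmx, {homo tnth p : i i' / (i < i')%N},
     forall i i', (G *m N) i' (tnth p i) = (i' == i)%:R &
     forall i (j : 'I_d), (j < tnth p i)%N -> (G *m N) i j = 0].
Proof.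
move=> freeN; pose c j : 'cV[K]_k := if insub j is Some j' then col j' N else 0.
have cE (j : 'I_d) : c j = col j N by rewrite /c valK.
have c_full : <<mkseq c d>>%VS = fullv.
  apply/eqP; rewrite eqEsubv subvf /=; apply/subvP => y _.
  rewrite -[y]mul1mx -(mulmxVp freeN) -mulmxA mulmx_cols.
  apply: memv_suml => j _; apply/memvZ/memv_span.
  by rewrite -cE; apply/mapP; exists (j : nat); rewrite ?mem_iota ?ltn_ord.
pose P := pivot_indices c d.
have sizeP : size P = k.
  rewrite -(size_map c); have /eqP := free_pivot_indices c d.
  by rewrite span_pivot_indices c_full dimvf /dim /= muln1 => <-.
have P_lt j : j \in P -> (j < d)%N.
  by rewrite mem_filter mem_iota add0n => /and3P[].
have p_subproof (i : 'I_k) : (nth 0%N P i < d)%N.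
  by apply/P_lt/mem_nth; rewrite sizeP.
pose p := [tuple Ordinal (p_subproof i) | i < k].
have pE i : tnth p i = nth 0%N P i :> nat by rewrite tnth_mktuple.
have P_p j : j \in P -> exists i, j = tnth p i.
  move=> jP; have iP : (index j P < k)%N by rewrite -sizeP index_mem.
  by exists (Ordinal iP); rewrite pE nth_index.
have p_homo : {homo tnth p : i i' / (i < i')%N}.
  move=> i i' ii'; rewrite !pE.
  apply: (sorted_ltn_nth ltn_trans 0%N (sorted_pivot_indices c d));
    by rewrite ?inE ?sizeP.
pose NP := colsub (tnth p) N.
(* a functional killing the pivot columns before j kills all columns before j *)
have kill (f : 'rV[K]_k) (j : nat) :
    (forall i, (tnth p i < j)%N -> f *m c (tnth p i) = 0) ->
  forall l, (l < j <= d)%N -> f *m c l = 0.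
  move=> f0 l /andP[lj jd].
  have : c l \in lker (linfun (mulmx f)).
    have : c l \in <<mkseq c j>>%VS.
      by apply/memv_span/mapP; exists l; rewrite ?mem_iota.
    rewrite -span_pivot_indices; apply/subvP/span_subvP => y /mapP[q qP ->].
    rewrite memv_ker lfunE /=; move: qP.
    rewrite mem_filter mem_iota add0n => /andP[cq /andP[_ qj]].
    have [i qi] : exists i, q = tnth p i.
      by apply: P_p; rewrite mem_filter cq mem_iota add0n (leq_trans qj).
    by rewrite qi f0 // -qi.
  by rewrite memv_ker lfunE => /eqP.
have mulN q (A : 'M[K]_(q, k)) i j : (A *m N) i j = (row i A *m c j) 0 0.
  by rewrite cE !mxE; apply: eq_bigr => l _; rewrite !mxE.
have NP_unit : NP \in unitmx.
  rewrite unitmxE unitfE; apply/det0P => -[f f_neq0 fNP]; case/negP: f_neq0.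
  rewrite -(inj_eq (row_free_inj freeN)) mul0mx; apply/eqP/rowP => j.
  rewrite mulN [row _ _]row_id (kill f d) ?mxE ?ltn_ord ?leqnn // => i _.
  apply/rowP => z; rewrite !ord1 -[f](row_id 0) -mulN.
  by move/rowP: fNP => /(_ i); rewrite mulmx_colsub !mxE.
have GN i i' : (invmx NP *m N) i' (tnth p i) = (i' == i)%:R.
  have := mulVmx NP_unit; rewrite mulmx_colsub => /matrixP/(_ i' i).
  by rewrite [LHS]mxE [RHS]mxE.
exists p, (invmx NP); split=> //; first by rewrite unitmx_inv.
move=> i j ji; rewrite mulN (kill (row i (invmx NP)) j.+1) ?mxE ?ltnSn ?ltn_ord //.
move=> i' i'j; apply/rowP => z; rewrite !ord1 -mulN GN mxE.
by case: eqP => // ii'; move: i'j; rewrite -ii' ltnS leqNgt ji.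
Qed.
Section PivotVectors.
Context {R : realType} {d : nat}.
Variable v : d.-tuple 'cV[R]_d.
Hypothesis v_basis : basis_of fullv v.
Let B := mxcols v.

Lemma span_mxcols (n : nat) (t : n.-tuple 'cV[R]_d) (w : 'cV[R]_d) :
  reflect (exists e, w = mxcols t *m e) (w \in <<t>>%VS).
Proof.
have -> : (t : seq _) = [seq col j (mxcols t) | j : 'I_n].
  rewrite -[in LHS](map_tnth_enum t); apply: eq_map => j.
  by rewrite col_mxcols.
exact: mem_span_col.
Qed.

Lemma span_echelon_rows (k : nat) (M : 'M[R]_(k, d)) :
  <<[seq (\sum_j M i j *: tnth v j)%R | i : 'I_k]>>%VS =
  <<[seq col i (B *m M^T) | i : 'I_k]>>%VS.
Proof.
congr <<_>>%VS; apply: eq_map => i.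
rewrite colE -mulmxA -colE mulmx_cols; apply: eq_bigr => j _.
by rewrite !mxE col_mxcols.
Qed.

Lemma pivot_vector_mem (k : nat) (V : {vspace 'cV[R]_d}) (p : k.-tuple 'I_d) :
  is_pivot_vector v V p -> exists2 M : 'M[R]_(k, d), is_rref_with_pivots M p &
    forall w, (exists e, w = B *m M^T *m e) <-> (w \in V).
Proof.
case=> M [Mp _ ->]; exists M => // w.
rewrite span_echelon_rows; exact: rwP (mem_span_col _ _).
Qed.

(** Put the coordinates on [v] of a basis of [V] in the rows of a matrix and
    reduce it. *)
Lemma pivot_vector_exists (k : nat) (V : {vspace 'cV[R]_d}) : \dim V = k ->
  exists p : k.-tuple 'I_d, is_pivot_vector v V p.
Proof.
move=> dimV; have B_unit : B \in unitmx by exact: mxcols_unit.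
case: k / dimV; pose U := mxcols (vbasis V); pose N := (invmx B *m U)^T.
have UE : U = B *m N^T by rewrite trmxK mulKVmx.
have freeN : row_free N.
  apply: inj_row_free => f fN; apply/eqP; rewrite -trmx_eq0; apply/eqP.
  apply: (free_mxcols (basis_free (vbasisP V))); rewrite -/U UE -mulmxA -trmx_mul.
  by rewrite fN trmx0 mulmx0.
have [p [G [G_unit p_homo Gp Glt]]] := echelon_form freeN.
exists p, (G *m N); split.
- split=> // [i|i i' i'i]; first by rewrite Gp eqxx.
  by rewrite Gp (negPf i'i).
- by rewrite mxrankMfree // mxrank_unit.
- apply/vspaceP => w.
  rewrite span_echelon_rows.
  have BGE : B *m (G *m N)^T = U *m G^T by rewrite trmx_mul mulmxA -UE.
  rewrite BGE -[in LHS](span_basis (vbasisP V)).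
  apply/span_mxcols/mem_span_col => -[e ->]; rewrite -/U.
    by exists (invmx G^T *m e); rewrite mulmxA mulmxK // unitmx_tr.
  by exists (G^T *m e); rewrite mulmxA.
Qed.

Lemma pivotsP (k : nat) (V : {vspace 'cV[R]_d}) : \dim V = k ->
  exists2 p : k.-tuple 'I_d, is_pivot_vector v V p & pivots k v V = p.
Proof.
move=> /pivot_vector_exists[p pP]; rewrite /pivots.
by case: pickP => [q /asboolP qP|/(_ p)/asboolP//]; exists q.
Qed.

End PivotVectors.

(** * Euclidean norms and determinants *)

Section NormBounds.
Context {R : realType} {d : nat}.
Implicit Types (u w : 'cV[R]_d) (A : 'M[R]_d).

Lemma dotC u w : dot u w = dot w u.
Proof. by apply: eq_bigr => i _; rewrite mulrC. Qed.

Lemma dotDl u u' w : dot (u + u') w = dot u w + dot u' w.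
Proof. by rewrite -big_split; apply: eq_bigr => i _; rewrite mxE mulrDl. Qed.

Lemma dotZl a u w : dot (a *: u) w = a * dot u w.
Proof. by rewrite mulr_sumr; apply: eq_bigr => i _; rewrite mxE mulrA. Qed.

Lemma sqr_enormD u w :
  enorm (u + w) ^+ 2 = enorm u ^+ 2 + dot u w *+ 2 + enorm w ^+ 2.
Proof. by rewrite !sqr_enorm dotDl !(dotC _ (u + w)) !dotDl (dotC w u); ring. Qed.

Lemma enormZ a u : enorm (a *: u) = `|a| * enorm u.
Proof.
by rewrite /enorm dotZl dotC dotZl mulrA -expr2 sqrtrM ?sqr_ge0 // sqrtr_sqr.
Qed.

Lemma enorm0 : enorm (0 : 'cV[R]_d) = 0.
Proof. by rewrite -[0](scale0r 0) enormZ normr0 mul0r. Qed.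

Lemma dot0l u : dot 0 u = 0.
Proof. by rewrite -[X in dot X](scale0r 0) dotZl mul0r. Qed.

Lemma cauchy_schwarz u w : dot u w <= enorm u * enorm w.
Proof.
have [->|u_neq0] := eqVneq u 0.
  by rewrite enorm0 mul0r dot0l.
have [->|w_neq0] := eqVneq w 0.
  by rewrite enorm0 mulr0 dotC dot0l.
rewrite -!enorm_gt0 in u_neq0 w_neq0.
(* this square is 2 |u| |w| (|u| |w| - <u, w>) *)
have := dot_ge0 (enorm w *: u + (- enorm u) *: w).
rewrite -sqr_enorm sqr_enormD !enormZ dotZl dotC dotZl dotC normrN.
rewrite !ger0_norm ?enorm_ge0 //.
set a := enorm u; set b := enorm w; set c := dot u w => h.
have ab_gt0 : 0 < a * b by rewrite mulr_gt0.
rewrite -(ler_pM2l ab_gt0); nra.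
Qed.

Lemma enormD u w : enorm (u + w) <= enorm u + enorm w.
Proof.
rewrite -ler_sqr ?nnegrE ?addr_ge0 ?enorm_ge0 // sqr_enormD sqrrD.
by rewrite lerD2r lerD2l lerMn2r cauchy_schwarz orbT.
Qed.

Lemma enorm_sum (I : finType) (P : pred I) (F : I -> 'cV[R]_d) :
  enorm (\sum_(i | P i) F i) <= \sum_(i | P i) enorm (F i).
Proof.
elim/big_rec2: _ => [|i y x _ h]; first by rewrite enorm0.
by rewrite (le_trans (enormD _ _)) // lerD2l.
Qed.

Lemma entry_le_enorm u i : `|u i 0| <= enorm u.
Proof.
rewrite -sqrtr_sqr ler_wsqrtr // /dot (bigD1 i) //= -expr2 lerDl sumr_ge0 //.
by move=> j _; rewrite -expr2 sqr_ge0.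
Qed.

Lemma orthproj_id (V : {vspace 'cV[R]_d}) w : w \in V -> orthproj V *m w = w.
Proof.
move=> wV; have [PwV Pw] := orthprojP V w; apply/esym/eqP.
by rewrite -subr_eq0 -dot_eq0 Pw // memvB.
Qed.

Lemma enorm_orthproj (V : {vspace 'cV[R]_d}) w : enorm (orthproj V *m w) <= enorm w.
Proof.
have [PwV Pw] := orthprojP V w.
rewrite -ler_sqr ?nnegrE ?enorm_ge0 // -[w in leRHS](subrK (orthproj V *m w)).
by rewrite addrC sqr_enormD Pw // mul0rn addr0 lerDl sqr_ge0.
Qed.

(** The Leibniz formula has [d!] terms, each at most the product of the norms of
    the columns.  The factor [d!] is harmless for exponential rates. *)
Lemma hadamard_weak A : `|\det A| <= d`!%:R * \prod_j enorm (col j A).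
Proof.
rewrite -det_tr (le_trans (ler_norm_sum _ _ _)) //.
rewrite -card_Sn mulr_natl -sumr_const ler_sum // => s _.
rewrite normrM normrX normrN1 expr1n mul1r normr_prod ler_prod // => i _.
rewrite normr_ge0 /= mxE; have := entry_le_enorm (col i A) (s i).
by rewrite mxE.
Qed.

End NormBounds.

(** * Singular values of a matrix restricted to a subspace *)

Section PivotSingularValues.
Context {R : realType} {d : nat}.
Variable v : d.-tuple 'cV[R]_d.
Hypothesis v_basis : basis_of fullv v.
Let B := mxcols v.
Implicit Types (X : 'M[R]_d) (V : {vspace 'cV[R]_d}).

(** A crude norm of the inverse of the basis matrix.  Only its independence of
    the subspace matters. *)
Definition coord_const : R := \sum_i \sum_j `|invmx B i j|.

Lemma coord_const_ge0 : 0 <= coord_const.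
Proof. by apply: sumr_ge0 => i _; apply: sumr_ge0 => j _. Qed.

Lemma coord_le (e : 'cV[R]_d) j : `|e j 0| <= coord_const * enorm (B *m e).
Proof.
have {1}-> : e = invmx B *m (B *m e) by rewrite mulKmx // mxcols_unit.
rewrite mxE (le_trans (ler_norm_sum _ _ _)) // /coord_const.
rewrite [X in _ <= X * _](bigD1 j) //=.
rewrite mulrDl ler_wpDr //.
  by rewrite mulr_ge0 ?enorm_ge0 // sumr_ge0 // => i _; rewrite sumr_ge0.
rewrite mulr_suml ler_sum // => i _.
by rewrite normrM ler_wpM2l // entry_le_enorm.
Qed.

Lemma enorm_mul_basis_le X (e : 'cV[R]_d) (P : pred 'I_d) :
    (forall j, ~~ P j -> e j 0 = 0) ->
  enorm (X *m (B *m e)) <= \sum_(j | P j) `|e j 0| * enorm (X *m tnth v j).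
Proof.
move=> e0; rewrite mulmx_cols linear_sum /= (bigID P) /= [X in _ + X]big1 => [|j Pj].
  rewrite addr0 (le_trans (enorm_sum _ _)) // ler_sum // => j _.
  by rewrite linearZ /= enormZ col_mxcols.
by rewrite e0 // scale0r linear0.
Qed.

Lemma echelon_coord (k : nat) (M : 'M[R]_(k, d)) (p : k.-tuple 'I_d)
    (e : 'cV[R]_k) a :
  is_rref_with_pivots M p -> (M^T *m e) (tnth p a) 0 = e a 0.
Proof.
case=> _ Mp _ Mp0; rewrite mxE (bigD1 a) //= mxE Mp mul1r big1 ?addr0 // => b ba.
by rewrite mxE Mp0 // mul0r.
Qed.

(** In particular [i < d], which makes [i] an index of a singular value of a
    [d * d] matrix. *)
Lemma pivot_ge_index (k : nat) (p : k.-tuple 'I_d) (i : 'I_k) :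
  {homo tnth p : i i' / (i < i')%N} -> (i <= tnth p i)%N.
Proof.
move=> p_homo; case: i => i; elim: i => // i IHi ik.
exact: leq_ltn_trans (IHi (ltnW ik)) (p_homo (Ordinal (ltnW ik)) (Ordinal ik) _).
Qed.

(** The [i] equations say that the coordinates of [P_V w] at the first [i] pivots
    vanish.  These are its first [i] coordinates on the echelon rows, so [P_V w]
    is a combination of the later rows, which involve only the [v_j] with
    [j >= p_i]. *)
Lemma singular_value_pivot_le (k : nat) V (p : k.-tuple 'I_d) X (i : 'I_k) :
    is_pivot_vector v V p ->
  (singular_values (X *m orthproj V))`_i <=
    coord_const * \sum_(j < d | (tnth p i <= j)%N) enorm (X *m tnth v j).
Proof.
move=> /pivot_vector_mem[M Mp memV]; have [p_homo _ Mlt _] := Mp.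
have id := leq_ltn_trans (pivot_ge_index i p_homo) (ltn_ord _).
pose N a : 'rV[R]_d :=
  if insub a is Some a' then row (tnth p a') (invmx B *m orthproj V) else 0.
apply: (singular_value_le (i := Ordinal id) (N := N)) => [|w Nw].
  by rewrite mulr_ge0 ?coord_const_ge0 // sumr_ge0 // => j _; exact: enorm_ge0.
have [PwV _] := orthprojP V w; have [_ /(_ PwV)[e Pw]] := memV (orthproj V *m w).
pose y := M^T *m e; have {}Pw : orthproj V *m w = B *m y by rewrite Pw mulmxA.
have yE : y = invmx B *m orthproj V *m w.
  by rewrite -mulmxA Pw mulKmx // mxcols_unit.
have e0 (a : 'I_k) : (a < i)%N -> e a 0 = 0.
  move=> ai; rewrite -(echelon_coord e a Mp) -/y yE.
  have := Nw a ai; rewrite /N valK -row_mul => /rowP/(_ 0).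
  by rewrite mxE => ->; rewrite mxE.
have y0 (j : 'I_d) : ~~ (tnth p i <= j)%N -> y j 0 = 0.
  rewrite -ltnNge => jp; rewrite mxE big1 // => a _; rewrite mxE.
  have [ai|] := ltnP a i; first by rewrite e0 // mulr0.
  rewrite leq_eqVlt => /orP[/eqP ia|/p_homo ia].
    by rewrite Mlt ?mul0r // -(val_inj ia).
  by rewrite Mlt ?mul0r // (ltn_trans jp).
rewrite -mulmxA Pw (le_trans (enorm_mul_basis_le X y0)) //.
rewrite mulr_sumr mulr_suml ler_sum // => j _.
rewrite mulrAC ler_wpM2r ?enorm_ge0 // (le_trans (coord_le y j)) //.
by rewrite ler_wpM2l ?coord_const_ge0 // -Pw enorm_orthproj.
Qed.

(** Cramer's rule: replacing column [j] of [X B] by [X B e] multiplies the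
    determinant by the [j]-th entry of [e]. *)
Lemma cramer_bound X (e : 'cV[R]_d) j :
  `|e j 0| * `|\det (X *m B)| <=
    d`!%:R * \prod_(l | l != j) enorm (X *m tnth v l) * enorm (X *m (B *m e)).
Proof.
pose Z := X *m B; pose w := X *m (B *m e).
pose C : 'M[R]_d := \matrix_(a, b) if b == j then w a 0 else Z a b.
have detC : \det C = e j 0 * \det Z.
  rewrite (expand_det_col _ j); transitivity ((\adj Z *m w) j 0); last first.
    by rewrite /w (mulmxA X) mulmxA mul_adj_mx mul_scalar_mx mxE mulrC.
  rewrite mxE; apply: eq_bigr => a _; rewrite !mxE eqxx mulrC; congr (_ * _).
  congr (_ * \det _); apply/matrixP => a' b'; rewrite !mxE.
  by rewrite eq_sym (negPf (neq_lift _ _)).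
rewrite -normrM -detC (le_trans (hadamard_weak C)) // -mulrA ler_wpM2l //.
rewrite (bigD1 j) //= mulrC le_eqVlt; apply/orP; left; apply/eqP.
congr (_ * _); last by congr enorm; apply/colP => a; rewrite !mxE eqxx.
apply: eq_bigr => l lj; congr enorm; apply/colP => a.
rewrite !mxE (negPf lj); apply: eq_bigr => b _.
by rewrite mxE.
Qed.

(** A combination [w] of the first [i + 1] echelon rows has as coefficients its
    coordinates at the pivots, which Cramer's rule bounds in terms of [|X w|].
    The constants [c a] depend on [V] but not on [X], which is what the rate of a
    sequence of matrices [X] requires. *)
Lemma singular_value_pivot_ge (k : nat) V (p : k.-tuple 'I_d) :
    is_pivot_vector v V p ->
  exists2 c : 'I_k -> R, (forall a, 0 <= c a) &
  forall X (i : 'I_k), X \in unitmx ->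
  1 <= (\sum_(a < k | (a <= i)%N)
          c a * (\prod_(l | l != tnth p a) enorm (X *m tnth v l) / `|\det X|)) *
       (singular_values (X *m orthproj V))`_i.
Proof.
move=> /pivot_vector_mem[M Mp memV]; have [p_homo _ Mlt _] := Mp.
have B_unit : B \in unitmx by exact: mxcols_unit.
pose Y := B *m M^T; pose c a := enorm (col a Y) * (d`!%:R / `|\det B|).
exists c => [a|X i X_unit]; first by rewrite mulr_ge0 ?enorm_ge0 // divr_ge0.
have prod_ge0 (j : 'I_d) : 0 <= \prod_(l | l != j) enorm (X *m tnth v l).
  by apply: prodr_ge0 => l _; exact: enorm_ge0.
apply: (singular_value_ge (Y := Y)).
  by apply: sumr_ge0 => a _; rewrite !mulr_ge0 ?divr_ge0 ?enorm_ge0.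
move=> e e_neq0 e0; have YeE : Y *m e = B *m (M^T *m e) by rewrite mulmxA.
split.
  apply: contra e_neq0 => /eqP Ye0; apply/eqP/colP => a.
  rewrite -(echelon_coord e a Mp).
  have -> : M^T *m e = 0 by rewrite -[LHS](mulKmx B_unit) -YeE Ye0 mulmx0.
  by rewrite !mxE.
have YeV : Y *m e \in V by apply/memV; exists e.
rewrite -[(X *m _) *m _]mulmxA (orthproj_id YeV).
rewrite {1}mulmx_cols (le_trans (enorm_sum _ _)) //.
rewrite (bigID (fun a : 'I_k => (a <= i)%N)) /= [X in _ + X]big1 => [|a]; last first.
  by rewrite -ltnNge => /e0 ->; rewrite scale0r enorm0.
rewrite addr0 mulr_suml ler_sum // => a _; rewrite enormZ mulrC /c -!mulrA.
rewrite ler_wpM2l ?enorm_ge0 // -(echelon_coord e a Mp).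
have := cramer_bound X (M^T *m e) (tnth p a); rewrite det_mulmx normrM -YeE.
have detX : 0 < `|\det X| by rewrite normr_gt0 -unitfE -unitmxE.
have detB : 0 < `|\det B| by rewrite normr_gt0 -unitfE -unitmxE.
rewrite -ler_pdivlMr ?mulr_gt0 // => /le_trans; apply.
by rewrite le_eqVlt; apply/orP; left; apply/eqP; field; rewrite !gt_eqF.
Qed.

End PivotSingularValues.

(** * Exponential rates *)

Section ExponentialGrowth.
Context {R : realType}.
Implicit Types (a b : nat -> R) (L : R).

(** The two halves of a limit of [ln (a n) / n], in a form that makes sense for
    sequences with zero terms and, for the upper half, is stable under finite
    sums. *)
Definition growth_le a L :=
  forall eps, 0 < eps -> \forall n \near \oo, a n <= expR (n%:R * (L + eps)).

Definition growth_ge a L :=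
  forall eps, 0 < eps -> \forall n \near \oo, expR (n%:R * (L - eps)) <= a n.

Lemma growthP a L : (\forall n \near \oo, 0 < a n) ->
  (n%:R^-1 * ln (a n) @[n --> \oo] --> L) <-> growth_le a L /\ growth_ge a L.
Proof.
move=> a_gt0; split=> [/cvgrPdist_le aL|[ale age]].
  split=> eps eps_gt0; near=> n.
    have n_gt0 : 0 < n%:R :> R by near: n; exact: nbhs_infty_gtr.
    have an : 0 < a n by near: n.
    rewrite -[a n]lnK ?posrE // ler_expR -ler_pdivrMl //.
    have : `|L - n%:R^-1 * ln (a n)| <= eps by near: n; exact: aL.
    by rewrite ler_norml => /andP[h _]; lra.
  have n_gt0 : 0 < n%:R :> R by near: n; exact: nbhs_infty_gtr.
  have an : 0 < a n by near: n.
  rewrite -[a n]lnK ?posrE // ler_expR -ler_pdivlMl //.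
  have : `|L - n%:R^-1 * ln (a n)| <= eps by near: n; exact: aL.
  by rewrite ler_norml => /andP[_ h]; lra.
apply/cvgrPdist_le => eps eps_gt0; near=> n.
have n_gt0 : 0 < n%:R :> R by near: n; exact: nbhs_infty_gtr.
have an : 0 < a n by near: n.
rewrite ler_norml; apply/andP; split.
  have : a n <= expR (n%:R * (L + eps)) by near: n; exact: ale.
  rewrite -{1}[a n]lnK ?posrE // ler_expR -ler_pdivrMl // => h; lra.
have : expR (n%:R * (L - eps)) <= a n by near: n; exact: age.
rewrite -{1}[a n]lnK ?posrE // ler_expR -ler_pdivlMl // => h; lra.
Unshelve. all: by end_near. Qed.

Lemma growth_le_weaken a L L' : L <= L' -> growth_le a L -> growth_le a L'.
Proof.
move=> LL' aL eps eps_gt0; near=> n.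
apply: le_trans (_ : expR (n%:R * (L + eps)) <= _); first by near: n; exact: aL.
by rewrite ler_expR ler_wpM2l // lerD2r.
Unshelve. all: by end_near. Qed.

Lemma growth_le_cst c : growth_le (fun=> c) 0.
Proof.
move=> eps eps_gt0; near=> n; rewrite add0r.
apply: le_trans (_ : n%:R * eps <= _).
  by rewrite -ler_pdivrMr //; near: n; exact: nbhs_infty_ger.
by apply: le_trans (expR_ge1Dx _); rewrite lerDr.
Unshelve. all: by end_near. Qed.

Lemma growth_leM a b La Lb : (forall n, 0 <= a n) -> (forall n, 0 <= b n) ->
  growth_le a La -> growth_le b Lb -> growth_le (fun n => a n * b n) (La + Lb).
Proof.
move=> a_ge0 b_ge0 aL bL eps eps_gt0; near=> n.
have -> : n%:R * (La + Lb + eps) = n%:R * (La + eps / 2) + n%:R * (Lb + eps / 2).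
  by field.
rewrite expRD ler_pM //; near: n; [apply: aL | apply: bL]; by rewrite divr_gt0.
Unshelve. all: by end_near. Qed.

(** The factor [2] is absorbed by [expR (n * eps / 2)]. *)
Lemma growth_leD a b L : growth_le a L -> growth_le b L ->
  growth_le (fun n => a n + b n) L.
Proof.
move=> aL bL eps eps_gt0; have eps2_gt0 : 0 < eps / 2 by rewrite divr_gt0.
near=> n; apply: le_trans (_ : 2 * expR (n%:R * (L + eps / 2)) <= _).
  by rewrite mulr_natl mulr2n lerD //; near: n; [apply: aL | apply: bL].
have -> : n%:R * (L + eps) = n%:R * (0 + eps / 2) + n%:R * (L + eps / 2) by field.
rewrite expRD ler_wpM2r ?expR_ge0 //; near: n; exact: (growth_le_cst 2).
Unshelve. all: by end_near. Qed.

Lemma growth_le0 L : growth_le (fun=> 0) L.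
Proof. by move=> eps _; near=> n; rewrite expR_ge0. Unshelve. all: by end_near. Qed.

Lemma growth_le_sum (I : Type) (r : seq I) (P : pred I) (a : I -> nat -> R) L :
    (forall i, P i -> growth_le (a i) L) ->
  growth_le (fun n => \sum_(i <- r | P i) a i n) L.
Proof.
move=> aL; elim: r => [|i r IHr].
  have -> : (fun n => \sum_(i <- [::] | P i) a i n) = fun=> 0.
    by apply/funext => n; rewrite big_nil.
  exact: growth_le0.
have -> : (fun n => \sum_(j <- i :: r | P j) a j n) =
    fun n => (if P i then a i n else 0) + \sum_(j <- r | P j) a j n.
  by apply/funext => n; rewrite big_cons; case: ifP; rewrite ?add0r.
apply: growth_leD => //.
by case: (P i) (aL i) => [/(_ isT)//|_]; exact: growth_le0.
Qed.

Lemma growth_le_prod (I : Type) (r : seq I) (P : pred I) (a : I -> nat -> R)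
    (L : I -> R) :
    (forall i n, 0 <= a i n) -> (forall i, P i -> growth_le (a i) (L i)) ->
  growth_le (fun n => \prod_(i <- r | P i) a i n) (\sum_(i <- r | P i) L i).
Proof.
move=> a_ge0 aL; elim: r => [|i r IHr].
  have -> : (fun n => \prod_(i <- [::] | P i) a i n) = fun=> 1.
    by apply/funext => n; rewrite big_nil.
  by rewrite big_nil; exact: growth_le_cst.
rewrite big_cons.
have -> : (fun n => \prod_(j <- i :: r | P j) a j n) =
    fun n => (if P i then a i n else 1) * \prod_(j <- r | P j) a j n.
  by apply/funext => n; rewrite big_cons; case: ifP; rewrite ?mul1r.
case: (P i) (aL i) => [/(_ isT) aiL|_].
  by apply: growth_leM => // n; exact: prodr_ge0.
by rewrite (_ : (fun n => _) = fun n => \prod_(j <- r | P j) a j n) //;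
  apply/funext => n; rewrite mul1r.
Qed.

Lemma growth_le_inv a L : growth_ge a L -> growth_le (fun n => (a n)^-1) (- L).
Proof.
move=> aL eps eps_gt0; near=> n.
have an : expR (n%:R * (L - eps)) <= a n by near: n; exact: aL.
have -> : n%:R * (- L + eps) = - (n%:R * (L - eps)) by ring.
rewrite expRN lef_pV2 // posrE ?expR_gt0 //.
exact: lt_le_trans (expR_gt0 _) an.
Unshelve. all: by end_near. Qed.

Lemma growth_le_dual a b L :
    (forall n, 0 <= b n) -> (forall n, 1 <= a n * b n) ->
  growth_le a (- L) -> growth_ge b L.
Proof.
move=> b_ge0 ab aL eps eps_gt0; near=> n.
have an : a n <= expR (n%:R * (- L + eps)) by near: n; exact: aL.
have -> : n%:R * (L - eps) = - (n%:R * (- L + eps)) by ring.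
rewrite expRN -[leLHS]mulr1 ler_pdivrMl ?expR_gt0 //.
exact: le_trans (ab n) (ler_wpM2r (b_ge0 n) an).
Unshelve. all: by end_near. Qed.

End ExponentialGrowth.

(** * The singular value function *)

Section SingularValueFunction.
Context {R : realType} {d : nat}.
Implicit Types (X : 'M[R]_d) (b : nat -> R).

(** The exponent of the singular value function when the [i]-th singular value
    is [expR (b i)]. *)
Definition interp_sum (s : R) b : R :=
  let j := Num.truncn s in \sum_(i < j) b i + (s - j%:R) * b j.

(** The last item covers [s = k]: the last factor of the singular value function
    is then a zeroth power, so that bounds on the singular values of index less
    than [k] suffice. *)
Lemma truncn_bounds (k : nat) (s : R) : 0 <= s <= k%:R ->
  [/\ (Num.truncn s <= k)%N, 0 <= s - (Num.truncn s)%:R &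
      (Num.truncn s = k -> s - (Num.truncn s)%:R = 0)].
Proof.
move=> /andP[s_ge0 sk]; have /andP[js _] := truncn_itv s_ge0.
split; first by rewrite -(ler_nat R) (le_trans js).
  by rewrite subr_ge0.
by move=> jk; apply/eqP; rewrite eq_le !subr_le0 subr_ge0 js jk sk.
Qed.

Lemma svf_le (k : nat) (s : R) X b : 0 <= s <= k%:R ->
    (forall i, (i < k)%N -> (singular_values X)`_i <= expR (b i)) ->
  svf s X <= expR (interp_sum s b).
Proof.
move=> sk Xb; have [jk sj_ge0 sj0] := truncn_bounds sk.
rewrite /svf /interp_sum; set j := Num.truncn s in jk sj_ge0 sj0 *.
rewrite expRD expR_sum ler_pM ?powR_ge0 //.
- by apply: prodr_ge0 => i _; exact: singular_value_ge0.
- apply: ler_prod => i _; rewrite singular_value_ge0 Xb //.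
  exact: leq_trans (ltn_ord i) jk.
move: jk; rewrite leq_eqVlt => /orP[/eqP/sj0 ->|jk].
  by rewrite powRr0 mul0r expR0.
by rewrite mulrC expRM ge0_ler_powR ?nnegrE ?expR_ge0 ?singular_value_ge0 ?Xb.
Qed.

Lemma svf_ge (k : nat) (s : R) X b : 0 <= s <= k%:R ->
    (forall i, (i < k)%N -> expR (b i) <= (singular_values X)`_i) ->
  expR (interp_sum s b) <= svf s X.
Proof.
move=> sk Xb; have [jk sj_ge0 sj0] := truncn_bounds sk.
rewrite /svf /interp_sum; set j := Num.truncn s in jk sj_ge0 sj0 *.
rewrite expRD expR_sum ler_pM ?expR_ge0 //.
- by apply: prodr_ge0 => i _; exact: expR_ge0.
- apply: ler_prod => i _; rewrite expR_ge0 Xb //.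
  exact: leq_trans (ltn_ord i) jk.
move: jk; rewrite leq_eqVlt => /orP[/eqP/sj0 ->|jk].
  by rewrite powRr0 mul0r expR0.
by rewrite mulrC expRM ge0_ler_powR ?nnegrE ?expR_ge0 ?singular_value_ge0 ?Xb.
Qed.

Lemma interp_sum_affine (s t c : R) b : 0 <= s ->
  interp_sum s (fun i => t * (b i + c)) = t * (interp_sum s b + s * c).
Proof.
move=> s_ge0; rewrite /interp_sum -mulr_sumr big_split /= sumr_const card_ord.
by rewrite -mulr_natl; ring.
Qed.

End SingularValueFunction.

(** * Growth along a regular sequence of matrices *)

Section PivotGrowth.
Context {R : realType} {d : nat}.
Variables (v : d.-tuple 'cV[R]_d) (A : nat -> 'M[R]_d) (Lambda : seq R).
Hypothesis v_basis : basis_of fullv v.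
Hypothesis A_unit : forall n, A n \in unitmx.
Hypothesis Lambda_nonincr :
  forall i j : 'I_d, (i <= j)%N -> Lambda`_j <= Lambda`_i.
Hypothesis v_growth : forall j,
  n%:R^-1 * ln (enorm (A n *m tnth v j)) @[n --> \oo] --> Lambda`_j.
Hypothesis det_growth :
  n%:R^-1 * ln `|\det (A n)| @[n --> \oo] --> \sum_(j < d) Lambda`_j.

Lemma enorm_basis_gt0 n j : 0 < enorm (A n *m tnth v j).
Proof.
rewrite enorm_gt0; apply: contraTneq (basis_not0 v_basis (mem_tnth j v)) => Av.
by rewrite -[tnth v j](mulKmx (A_unit n)) Av mulmx0 eqxx.
Qed.

Lemma basis_growth_le j : growth_le (fun n => enorm (A n *m tnth v j)) Lambda`_j.
Proof.
have an_gt0 : \forall n \near \oo, 0 < enorm (A n *m tnth v j).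
  by near=> n; exact: enorm_basis_gt0.
exact: ((growthP Lambda`_j an_gt0).1 (v_growth (j := j))).1.
Unshelve. all: by end_near. Qed.

Lemma det_growth_ge : growth_ge (fun n => `|\det (A n)|) (\sum_(j < d) Lambda`_j).
Proof.
have an_gt0 : \forall n \near \oo, 0 < `|\det (A n)|.
  by near=> n; rewrite normr_gt0 -unitfE -unitmxE.
exact: ((growthP _ an_gt0).1 det_growth).2.
Unshelve. all: by end_near. Qed.

(** The quantifier over subspaces is inside the one over [n]: the bounds for the
    [d] possible values of a pivot hold together from some [n] on. *)
Lemma uniform_singular_value_le (k : nat) eps : 0 < eps ->
  \forall n \near \oo, forall V (p : k.-tuple 'I_d) (i : 'I_k),
    is_pivot_vector v V p ->
    (singular_values (A n *m orthproj V))`_i <=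
      expR (n%:R * (Lambda`_(tnth p i) + eps)).
Proof.
move=> eps_gt0.
have : \forall n \near \oo, forall j : 'I_d,
    coord_const v * \sum_(l < d | (j <= l)%N) enorm (A n *m tnth v l) <=
      expR (n%:R * (Lambda`_j + eps)).
  apply: filter_forall => j.
  have := @growth_leM _ (fun=> coord_const v)
    (fun n => \sum_(l < d | (j <= l)%N) enorm (A n *m tnth v l)) 0 Lambda`_j.
  rewrite add0r; apply=> //.
  - by move=> n; exact: coord_const_ge0.
  - by move=> n; apply: sumr_ge0 => l _; exact: enorm_ge0.
  - exact: growth_le_cst.
  apply: growth_le_sum => l jl.
  exact: growth_le_weaken (Lambda_nonincr jl) (basis_growth_le l).
apply: filterS => n An V p i Vp.
exact: le_trans (singular_value_pivot_le (v_basis) (A n) i Vp) (An _).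
Qed.

(** In the bound of [singular_value_pivot_ge], the term of index [a] has rate
    [\sum_(l != p_a) Lambda_l - \sum_l Lambda_l = - Lambda_(p_a)], which is at
    most [- Lambda_(p_i)] as [p_a <= p_i]. *)
Lemma singular_value_growth_ge (k : nat) V (p : k.-tuple 'I_d) (i : 'I_k) :
    is_pivot_vector v V p ->
  growth_ge (fun n => (singular_values (A n *m orthproj V))`_i) Lambda`_(tnth p i).
Proof.
move=> Vp; have [c c_ge0 cX] := singular_value_pivot_ge v_basis Vp.
apply: growth_le_dual (fun n => cX _ i (A_unit n)) _ => [n|].
  exact: singular_value_ge0.
have [M [[p_homo _ _ _] _ _]] := Vp.
apply: growth_le_sum => a ai.
rewrite -[- _]add0r; apply: growth_leM => [//|n||].
- rewrite divr_ge0 //; apply: prodr_ge0 => l _; exact: enorm_ge0.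
- exact: growth_le_cst.
apply: (@growth_le_weaken _ _
  (\sum_(l | l != tnth p a) Lambda`_l - \sum_(l < d) Lambda`_l)).
  rewrite [X in _ - X](bigD1 (tnth p a)) //= opprD addrCA subrr addr0 lerN2.
  apply: Lambda_nonincr; move: ai.
  rewrite leq_eqVlt => /orP[/eqP/val_inj -> //|/p_homo].
  exact: ltnW.
apply: growth_leM => [n|n||].
- by apply: prodr_ge0 => l _; exact: enorm_ge0.
- by rewrite invr_ge0.
- by apply: growth_le_prod => [l n|l _]; [exact: enorm_ge0 | exact: basis_growth_le].
- exact: growth_le_inv det_growth_ge.
Qed.

Lemma nth_pivot_exponents (k : nat) (p : k.-tuple 'I_d) (i : 'I_k) :
  [seq Lambda`_j | j : 'I_d <- p]`_i = Lambda`_(tnth p i).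
Proof.
by rewrite (nth_map (tnth p i)) ?size_tuple // -tnth_nth.
Qed.

Lemma uniform_svf_le (k : nat) (s eps : R) : 0 <= s <= k%:R -> 0 < eps ->
  \forall n \near \oo, forall V (p : k.-tuple 'I_d), is_pivot_vector v V p ->
    svf s (A n *m orthproj V) <= expR (n%:R * (pivot_exponent s Lambda p + eps)).
Proof.
move=> sk eps_gt0; have s_ge0 : 0 <= s by case/andP: sk.
have s1_gt0 : 0 < s + 1 by rewrite ltr_wpDl.
(* an error in each exponent is multiplied by s in the singular value function *)
have eps'_gt0 : 0 < eps / (s + 1) by rewrite divr_gt0.
apply: filterS (uniform_singular_value_le k eps'_gt0) => n An V p Vp.
pose b i := n%:R * ([seq Lambda`_j | j : 'I_d <- p]`_i + eps / (s + 1)).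
have /(svf_le sk) /le_trans : forall i, (i < k)%N ->
    (singular_values (A n *m orthproj V))`_i <= expR (b i).
  move=> i ik; rewrite /b (nth_pivot_exponents p (Ordinal ik)).
  exact: (An V p (Ordinal ik)).
apply; rewrite ler_expR /b interp_sum_affine // ler_wpM2l // lerD2l.
by rewrite mulrA ler_pdivrMr // [leRHS]mulrC ler_wpM2r ?(ltW eps_gt0) // lerDl.
Qed.

Lemma svf_growth_ge (k : nat) (s : R) V (p : k.-tuple 'I_d) : 0 <= s <= k%:R ->
    is_pivot_vector v V p ->
  growth_ge (fun n => svf s (A n *m orthproj V)) (pivot_exponent s Lambda p).
Proof.
move=> sk Vp eps eps_gt0; have s_ge0 : 0 <= s by case/andP: sk.
have s1_gt0 : 0 < s + 1 by rewrite ltr_wpDl.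
have eps'_gt0 : 0 < eps / (s + 1) by rewrite divr_gt0.
have : \forall n \near \oo, forall i : 'I_k,
    expR (n%:R * (Lambda`_(tnth p i) - eps / (s + 1))) <=
      (singular_values (A n *m orthproj V))`_i.
  by apply: filter_forall => i; exact: singular_value_growth_ge.
apply: filterS => n An.
pose b i := n%:R * ([seq Lambda`_j | j : 'I_d <- p]`_i + - (eps / (s + 1))).
have /(svf_ge sk) : forall i, (i < k)%N ->
    expR (b i) <= (singular_values (A n *m orthproj V))`_i.
  move=> i ik; rewrite /b (nth_pivot_exponents p (Ordinal ik)).
  exact: (An (Ordinal ik)).
apply: le_trans; rewrite ler_expR /b interp_sum_affine // ler_wpM2l // lerD2l.
rewrite mulrN lerN2 mulrA ler_pdivrMr // [leRHS]mulrC.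
by rewrite ler_wpM2r ?(ltW eps_gt0) // lerDl.
Qed.

Lemma svf_growth (k : nat) (s : R) V (p : k.-tuple 'I_d) : 0 <= s <= k%:R ->
    is_pivot_vector v V p ->
  n%:R^-1 * ln (svf s (A n *m orthproj V)) @[n --> \oo] -->
    pivot_exponent s Lambda p.
Proof.
move=> sk Vp; have svf_ge := svf_growth_ge sk Vp; apply/growthP.
  by apply: filterS (svf_ge 1 ltr01) => n; apply: lt_le_trans (expR_gt0 _).
split=> // eps eps_gt0.
by apply: filterS (uniform_svf_le sk eps_gt0) => n; exact.
Qed.

(** The set of exponents is bounded because there are finitely many pivot
    vectors.  The set of values of [svf] is bounded for large [n], by the uniform
    upper bound; this matters because the supremum of an unbounded set is [0] by
    convention. *)
Lemma sup_svf_growth (k : nat) (s : R) (I : Type) (J0 : I)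
    (V : I -> {vspace 'cV[R]_d}) :
    0 <= s <= k%:R -> (forall J, \dim (V J) = k) ->
  n%:R^-1 * ln (sup (range (fun J => svf s (A n *m orthproj (V J)))))
    @[n --> \oo] -->
  sup (range (fun J => pivot_exponent s Lambda (pivots k v (V J)))).
Proof.
move=> sk dimV; pose E J := pivot_exponent s Lambda (pivots k v (V J)).
pose L := sup (range E); rewrite -/L.
have VP J : exists2 p : k.-tuple 'I_d, is_pivot_vector v (V J) p &
  E J = pivot_exponent s Lambda p.
  by have [p Vp pE] := pivotsP v_basis (dimV J); exists p; rewrite // /E pE.
have has_supE : has_sup (range E).
  split; first by exists (E J0), J0.
  exists (\sum_(p : k.-tuple 'I_d) `|pivot_exponent s Lambda p|) => _ [J _ <-].
  have [p _ ->] := VP J; rewrite (bigD1 p) //= ler_wpDr ?sumr_ge0 //.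
  exact: ler_norm.
have E_le J : E J <= L by apply: sup_upper_bound => //; exists J.
pose F n J := svf s (A n *m orthproj (V J)).
have F_le eps : 0 < eps ->
    \forall n \near \oo, forall J, F n J <= expR (n%:R * (L + eps)).
  move=> eps_gt0; apply: filterS (uniform_svf_le sk eps_gt0) => n An J.
  have [p Vp EJ] := VP J; apply: le_trans (An _ _ Vp) _.
  by rewrite ler_expR ler_wpM2l // lerD2r -EJ.
have F_sup : \forall n \near \oo, forall J, F n J <= sup (range (F n)).
  apply: filterS (F_le 1 ltr01) => n Fn J; apply: sup_upper_bound; last by exists J.
  split; first by exists (F n J), J.
  by exists (expR (n%:R * (L + 1))) => _ [J' _ <-].
have sup_ge : growth_ge (fun n => sup (range (F n))) L.
  move=> eps eps_gt0; have eps2_gt0 : 0 < eps / 2 by rewrite divr_gt0.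
  have [_ [J _ <-] LE] := sup_adherent eps2_gt0 has_supE.
  have [p Vp EJ] := VP J.
  near=> n; apply: le_trans (_ : F n J <= _); last by near: n; apply: filterS F_sup.
  apply: le_trans (_ : expR (n%:R * (pivot_exponent s Lambda p - eps / 2)) <= _).
    by rewrite ler_expR ler_wpM2l // -EJ; move: LE; rewrite -/L; lra.
  by near: n; exact: svf_growth_ge.
apply/growthP.
  by apply: filterS (sup_ge 1 ltr01) => n; apply: lt_le_trans (expR_gt0 _).
split=> // eps eps_gt0; apply: filterS (F_le _ eps_gt0) => n Fn.
by apply: ge_sup => [|_ [J _ <-]]; [exists (F n J0), J0 | exact: Fn].
Unshelve. all: by end_near. Qed.

End PivotGrowth.

(** * The Lyapunov exponents of the adapted basis *)

Section LyapunovList.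
Context {R : realType} {r : nat}.
Variables (lam : 'I_r -> R) (dd : 'I_r -> nat).

Lemma size_lyapunov_list : size (lyapunov_list dd lam) = (\sum_i dd i)%N.
Proof.
rewrite size_map size_flatten /shape -map_comp sumnE big_map big_enum /=.
by apply: eq_bigr => i _; rewrite /= size_nseq.
Qed.

Lemma lyapunov_list_nonincr i j :
    (forall a b : 'I_r, (a < b)%N -> lam b < lam a) ->
    (i <= j < \sum_i dd i)%N ->
  (lyapunov_list dd lam)`_j <= (lyapunov_list dd lam)`_i.
Proof.
move=> lam_decr; rewrite -size_lyapunov_list => /andP[ij jsize].
have L_sorted : sorted >=%R (lyapunov_list dd lam).
  rewrite sorted_pairwise; last exact: rev_trans le_trans.
  rewrite pairwise_map.
  apply: (pairwise_flatten_nseq (r := fun a b : 'I_r => (a < b)%N)) => [a b ab|a|].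
  - exact/ltW/lam_decr.
  - exact: lexx.
  rewrite -(pairwise_map val ltn) val_enum_ord -sorted_pairwise ?iota_ltn_sorted //.
  exact: ltn_trans.
have := sorted_leq_nth (rev_trans le_trans) lexx 0 L_sorted.
by apply; rewrite ?inE // (leq_ltn_trans ij).
Qed.

Lemma sum_lyapunov_list :
  \sum_(j < \sum_i dd i) (lyapunov_list dd lam)`_j = \sum_i (dd i)%:R * lam i.
Proof.
rewrite -size_lyapunov_list.
rewrite -(big_mkord xpredT (fun j => (lyapunov_list dd lam)`_j)).
rewrite -(big_nth 0 xpredT id) big_map big_flatten big_map big_enum /=.
by apply: eq_bigr => i _; rewrite big_nseq iter_addr_0 mulr_natl.
Qed.

End LyapunovList.

(** * Application to the Oseledets data *)

Lemma mxword_tr_unit (R : realType) (m d : nat) (T : 'I_m.+1 -> 'M[R]_d) I :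
  (forall i, T i \in unitmx) -> mxword_tr T I \in unitmx.
Proof.
move=> T_unit; rewrite /mxword_tr unitmx_tr /mxword.
by elim: I => [|i I IH]; rewrite ?big_nil ?unitmx1 // big_cons unitmx_mul T_unit.
Qed.

Lemma dim_mximg (R : realType) (d : nat) (A : 'M[R]_d) V :
  A \in unitmx -> \dim (mximg A V) = \dim V.
Proof.
move=> A_unit; apply: limg_dim_eq; apply/eqP; rewrite -subv0; apply/subvP => w.
rewrite memv_cap memv_ker lfunE /= memv0 => /andP[_ /eqP Aw].
by rewrite -[w](mulKmx A_unit) Aw mulmx0.
Qed.

Lemma wedge_norm1 (R : realType) (d : nat) (u : 'I_1 -> 'cV[R]_d) :
  wedge_norm u = enorm (u 0).
Proof. by rewrite /wedge_norm det_mx11 mxE. Qed.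

Theorem proposition3p3 (R : realType) (d m : nat) (hd : (2 <= d)%N)
    (T : 'I_m.+1 -> 'M[R]_d) (T_unit : forall i, T i \in unitmx)
    (mu : probability (Sigma m) R)
    (mu_inv : shift_invariant mu) (mu_erg : shift_ergodic mu)
    (S : set (Sigma m)) (r : nat) (lam : 'I_r -> R) (dd : 'I_r -> nat)
    (E : Sigma m -> 'I_r -> {vspace 'cV[R]_d})
    (v : Sigma m -> d.-tuple 'cV[R]_d)
    (data : oseledets_data T mu S lam dd E v)
    (k : nat) (hk : (1 <= k <= d.-1)%N)
    (W : {vspace 'cV[R]_d}) (dimW : \dim W = k)
    (s : R) (hs : 0 <= s <= k%:R) :
  let Lambda := lyapunov_list dd lam in
  forall x : Sigma m, S x ->
    (n%:R^-1 * ln (svf s (mxword_tr T (restr x n) *m orthproj W))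
       @[n --> \oo] --> pivot_exponent s Lambda (pivots k (v x) W)) /\
    (n%:R^-1 * ln (sup (range (fun J : seq 'I_m.+1 =>
         svf s (mxword_tr T (restr x n)
                  *m orthproj (mximg (mxword_tr T J) W)))))
       @[n --> \oo] -->
     sup (range (fun J : seq 'I_m.+1 =>
         pivot_exponent s Lambda
           (pivots k (v x) (mximg (mxword_tr T J) W))))).
Proof.
move=> Lambda x Sx; pose A n := mxword_tr T (restr x n).
have v_basis := os_v_basis data Sx; have sum_dd := os_dd_sum data.
have A_unit n : A n \in unitmx by exact: mxword_tr_unit.
have Lambda_nonincr (i j : 'I_d) : (i <= j)%N -> Lambda`_j <= Lambda`_i.
  move=> ij; apply: lyapunov_list_nonincr; first exact: os_lam data.
  by rewrite ij sum_dd ltn_ord.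
have v_growth j :
    n%:R^-1 * ln (enorm (A n *m tnth (v x) j)) @[n --> \oo] --> Lambda`_j.
  have := os_wedge data Sx (l := 1) (i := fun=> j).
  rewrite big_ord1 => wedge_growth.
  rewrite (_ : (fun n => _) = fun n => n%:R^-1 *
      ln (wedge_norm (fun _ : 'I_1 => A n *m tnth (v x) j))); last first.
    by apply/funext => n; rewrite wedge_norm1.
  by apply: wedge_growth => [|a b]; [case: (d) hd => [|[]] | rewrite !ord1].
have det_growth :
    n%:R^-1 * ln `|\det (A n)| @[n --> \oo] --> \sum_(j < d) Lambda`_j.
  by have := os_det data Sx; rewrite -sum_lyapunov_list sum_dd.
split; last first.
  apply: (sup_svf_growth v_basis A_unit Lambda_nonincr v_growth det_growth [::] hs).
  by move=> J; rewrite dim_mximg // mxword_tr_unit.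
have [p Wp ->] := pivotsP v_basis dimW.
exact: svf_growth Wp.
Qed.
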